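(* Let $n\ge1$ be an integer. For every non-empty Borel set $A\subset\mathbb{R}^n$, $$\begin{aligned}\dim_H A&=n-\inf\{\overline{\dim}_M B: B\subset\mathbb{R}^n\text{ is compact},\ \mathrm{int}(A+B)\ne\emptyset\}\\&=n-\inf\{\dim_P B: B\subset\mathbb{R}^n\text{ is compact},\ \mathrm{int}(A+B)\ne\emptyset\}\\&=n-\inf\{\dim_P B: B\subset\mathbb{R}^n\text{ is Borel},\ A+B=\mathbb{R}^n\}.\end{aligned}$$
   Context: $\dim_H$, $\dim_P$ and $\overline{\dim}_M$ denote Hausdorff, packing and upper Minkowski (upper box-counting) dimension respectively. $A+B=\{a+b:a\in A,\ b\in B\}$ is the Minkowski sum, and $\mathrm{int}$ denotes interior. *)

(* Defs.v *)
From mathcomp Require Import all_boot all_order all_algebra.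
From mathcomp Require Import all_classical all_reals all_analysis.
Set Implicit Arguments.
Unset Strict Implicit.
Unset Printing Implicit Defensive.
Import Order.TTheory GRing.Theory Num.Theory.
Import numFieldNormedType.Exports.
Local Open Scope classical_set_scope.
Local Open Scope ring_scope.

Section dimensions.
Context {R : realType} {n : nat}.
Implicit Types (A B E : set 'rV[R]_n) (x y : 'rV[R]_n) (r s delta : R).

(** The norm of the library on ['rV[R]_n] is the sup norm; it induces the same
    topology as [enorm], but all the metric notions below are Euclidean. *)
Definition enorm x : R := Num.sqrt (\sum_(i < n) x ord0 i ^+ 2).

Definition eball x r : set 'rV[R]_n := [set y | enorm (y - x) <= r].

Definition borel A : Prop := <<s [set U : set 'rV[R]_n | open U] >> A.

Definition minkowski_sum A B : set 'rV[R]_n := [set a + b | a in A & b in B].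

(** [0] is adjoined so that [ediam set0 = 0] rather than [-oo]. *)
Definition ediam A : \bar R :=
  ereal_sup (0%E |` [set (enorm (x - y))%:E | x in A & y in A]).

(** Countable families, finite or infinite, are indexed by a set [D] of natural
    numbers. Since [0 `^ 0 = 1], the case [s = 0] is the counting measure. *)
Definition hausdorff_content s delta A : \bar R :=
  ereal_inf [set v : \bar R | exists (D : set nat) (U : nat -> set 'rV[R]_n),
    [/\ A `<=` \bigcup_(i in D) U i,
        forall i, D i -> (ediam (U i) <= delta%:E)%E &
        v = (\esum_(i in D) (ediam (U i) `^ s))%E]].

(** The limit as [delta] tends to [0+] is a supremum, by monotonicity. *)
Definition hausdorff_measure s A : \bar R :=
  ereal_sup [set hausdorff_content s delta A | delta in [set d : R | 0 < d]].

Definition hausdorff_dim A : \bar R :=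
  ereal_inf [set s%:E | s in [set s : R | 0 <= s /\ hausdorff_measure s A = 0%E]].

(** [+oo] if no finite family of balls covers [A]. *)
Definition covering_number r A : \bar R :=
  ereal_inf [set (k%:R)%:E | k in [set k : nat |
    exists c : 'I_k -> 'rV[R]_n, A `<=` \bigcup_(i in [set: 'I_k]) eball (c i) r]].

Definition upper_minkowski_dim A : \bar R :=
  limf_esup (fun r => lne (covering_number r A) * ((ln r^-1)^-1)%:E)%E (0 : R)^'+.

(** Packings of [E] by disjoint closed balls of diameter at most [delta],
    centred in [E]. *)
Definition packing_content s delta E : \bar R :=
  ereal_sup [set v : \bar R |
    exists (D : set nat) (c : nat -> 'rV[R]_n) (r : nat -> R),
    [/\ forall i, D i -> E (c i),
        forall i, D i -> 0 < r i /\ 2 * r i <= delta,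
        trivIset D (fun i => eball (c i) (r i)) &
        v = (\esum_(i in D) ((2 * r i) `^ s)%:E)%E]].

Definition packing_premeasure s E : \bar R :=
  ereal_inf [set packing_content s delta E | delta in [set d : R | 0 < d]].

(** [packing_premeasure] is not countably subadditive, hence this second step. *)
Definition packing_measure s A : \bar R :=
  ereal_inf [set v : \bar R | exists E : nat -> set 'rV[R]_n,
    A `<=` \bigcup_i E i /\
    v = (\sum_(0 <= i <oo) packing_premeasure s (E i))%E].

Definition packing_dim A : \bar R :=
  ereal_inf [set s%:E | s in [set s : R | 0 <= s /\ packing_measure s A = 0%E]].

End dimensions.

(* Main.v *)
Require Import Defs.
From mathcomp Require Import finmap.
From mathcomp Require Import all_boot all_order all_algebra.
From mathcomp Require Import all_classical all_reals all_analysis.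
From mathcomp Require Import ring lra zify.
Import Order.TTheory GRing.Theory Num.Theory.
Import numFieldNormedType.Exports.
Local Open Scope classical_set_scope.
Local Open Scope ring_scope.
Set Implicit Arguments.
Unset Strict Implicit.
Unset Printing Implicit Defensive.

(** The lower bounds on the dimension of [B] come from [dim_H (A + B) <= dim_H A
    + dim_P B]: a set with interior is not Lebesgue null, whereas [A + B] would
    be null if [A] and [B] were null for exponents of sum at most [n]
    ([sum_dim_ge]). For the upper Minkowski dimension one also uses that it
    dominates the packing dimension ([packing_dim_le_minkowski]).

    The upper bounds require a small [B] such that [A + B] contains a unit cube
    ([sparse_complement]). Let [t < dim_H A]. Then [A] has positive content of
    exponent [t] for coverings by [b]-adic cells; since that content is a
    capacity ([content_increasing]) and Borel sets are analytic
    ([borel_analytic]), some compact [K] inside [A] already has positive content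
    ([analytic_compact_content]). Now choose [B] as the limit of a random tree
    of [b]-adic grid points, in which each level is refined and then thinned by
    a factor of order [b ^ (- t)]. Measure the mass of [K] in a cell of level
    [j] in the unit [b ^ (- j t)], which bounds it. A point [v] of the tree sees
    from a grid point [x] the mass of the cell [x - v]. Refinement followed by
    thinning at least doubles the total mass seen from [x], except with a
    probability exponentially small in the mass; as the mass grows exponentially
    with the level while the number of grid points is only exponential, the
    exceptional probabilities add up to less than one at each level. The
    existence of the tree is derived by the method of conditional expectations
    ([sampling_potential], [sparse_tree]). Hence every [x] in the unit box is
    seen at every level, and by compactness belongs to [K + B]
    ([tree_set_hits]). The [j]-th level has [b ^ (j (n - t))] points up to
    constants to the power [j], and these constants matter little for a large
    base [b], so that the upper Minkowski dimension of [B] is arbitrarily close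
    to [n - t]. If [dim_H A = 0], the same tree without thinning, for [K] a
    point, has levels of [b ^ (j n)] points up to such constants.

    For the third formula, the union of the translates of [B] by integer vectors
    is Borel, its packing dimension obeys the same bound by countable stability,
    and its sum with [A] is the whole space. *)

(** * Contents defined by countable coverings *)

Section EsumComplements.
Context {R : realType}.
Local Open Scope ereal_scope.

Lemma le_esum_subset (T : choiceType) (P Q : set T) (a : T -> \bar R) :
  P `<=` Q -> \esum_(i in P) a i <= \esum_(i in Q) a i.
Proof.
move=> PQ; apply: ge_ereal_sup => _ [F [finF FP] <-].
by apply: ereal_sup_ubound; exists F => //; split => //; exact: subset_trans PQ.
Qed.

Lemma esum_bigcup_le (T J : choiceType) (D : set J) (F : J -> set T)
    (a : T -> \bar R) : (forall q, 0 <= a q) ->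
  \esum_(q in \bigcup_(p in D) F p) a q <=
  \esum_(p in D) \esum_(q in F p) a q.
Proof.
move=> a0; set P := (X in esum X _).
have [[q0 Pq0]|nP] := pselect (P !=set0); last first.
  rewrite (_ : P = set0) ?esum_set0; last exact/nonemptyPn.
  by apply: esum_ge0 => p _; exact: esum_ge0.
have [p0 _ _] := Pq0.
have [g Pg] : exists g : T -> J, forall q, P q -> D (g q) /\ F (g q) q.
  have H q : exists p, P q -> D p /\ F p q.
    have [[p Dp Fp]|nPq] := pselect (P q); first by exists p.
    by exists p0.
  by have [g Hg] := boolp.choice H; exists g.
rewrite esum_esum//.
rewrite -(@esum_image _ _ _ P (fun q => (g q, q)) (fun k => a k.2)); last first.
  by move=> x y _ _ [].
by apply: le_esum_subset => _ [q /Pg[Dg Fg] <-].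
Qed.

(** The countable form of an epsilon of room: one half, one quarter, and so on. *)
Lemma esum_halves_le (J : countType) (D : set J) (e : R) : (0 <= e)%R ->
  \esum_(p in D) (e / (2 ^ (pickle p).+1)%:R)%:E <= e%:E.
Proof.
move=> e0; pose u n : \bar R := (e / (2 ^ n.+1)%:R)%:E.
have u0 n : 0 <= u n by rewrite lee_fin divr_ge0.
rewrite -(@esum_image _ _ _ D (@pickle J) u); last first.
  by move=> x y _ _; exact: (pcan_inj pickleK).
apply: le_trans (epsilon_trick0 xpredT e0).
rewrite nneseries_esumT//; exact: le_esum_subset.
Qed.

Lemma esum_le_term (T : choiceType) (P : set T) (a : T -> \bar R) p :
  (forall q, 0 <= a q) -> P p -> a p <= \esum_(i in P) a i.
Proof.
move=> a0 Pp; rewrite -(@esum_set1 _ _ p a)//.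
by apply: le_esum_subset => _ ->.
Qed.

Lemma esumZ_le (T : choiceType) (P : set T) (a : T -> \bar R) (k : R) (M : R) :
  (0 <= k)%R -> \esum_(i in P) a i <= M%:E -> (forall q, 0 <= a q) ->
  \esum_(i in P) (k%:E * a i) <= (k * M)%:E.
Proof.
move=> k0 aM a0; apply: ge_ereal_sup => _ [F [finF FP] <-].
rewrite -ge0_mule_fsumr// EFinM lee_wpmul2l//.
by apply: le_trans aM; apply: ereal_sup_ubound; exists F.
Qed.

End EsumComplements.

Section CoverContent.
Context {R : realType} {T : choiceType} {X : Type}.
Variables (w : T -> \bar R) (S : T -> set X).
Hypothesis w0 : forall p, (0 <= w p)%E.
Local Open Scope ereal_scope.

(** Caratheodory's outer measure generated by a gauge [w] on a family of cells. It
    serves twice: for [b]-adic cells charged a power of their side, and for balls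
    charged their volume. *)
Definition cover_content (E : set X) : \bar R :=
  ereal_inf [set \esum_(p in D) w p |
    D in [set D | E `<=` \bigcup_(p in D) S p]].

Lemma cover_content_le E D : E `<=` \bigcup_(p in D) S p ->
  cover_content E <= \esum_(p in D) w p.
Proof. by move=> ED; apply: ereal_inf_lbound; exists D. Qed.

Lemma cover_content_lt E v : cover_content E < v ->
  exists D, E `<=` \bigcup_(p in D) S p /\ \esum_(p in D) w p < v.
Proof. by move=> /ereal_inf_lt[_ [D ED <-] Dv]; exists D. Qed.

Lemma cover_content_ge0 E : 0 <= cover_content E.
Proof.
by apply: le_ereal_inf_tmp => _ [D _ <-]; apply: esum_ge0.
Qed.

Lemma le_cover_content E F : E `<=` F -> cover_content E <= cover_content F.
Proof.
move=> EF; apply: ereal_inf_le_tmp => _ [D FD <-]; exists D => //.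
exact: subset_trans FD.
Qed.

Lemma cover_content_cell p E : E `<=` S p -> cover_content E <= w p.
Proof.
move=> ES; rewrite -(esum_set1 (w0 p)); apply: cover_content_le => x /ES Sx.
by exists p.
Qed.

Lemma cover_content0 : cover_content set0 = 0.
Proof.
apply/le_anti; rewrite cover_content_ge0 andbT.
by rewrite -(esum_set0 w); exact: cover_content_le.
Qed.

Lemma cover_content_bigcup (J : countType) (D : set J) (F : J -> set X) E :
  E `<=` \bigcup_(p in D) F p ->
  cover_content E <= \esum_(p in D) cover_content (F p).
Proof.
move=> EF.
have [[p0 [Dp0 cp0]]|fin] := pselect (exists p, D p /\ cover_content (F p) = +oo).
  apply: (@le_trans _ _ +oo); first by rewrite leey.
  rewrite -cp0; apply: (esum_le_term (a := fun p => cover_content (F p))) => //.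
  by move=> q; exact: cover_content_ge0.
apply/lee_addgt0Pr => e e0.
pose ep (p : J) : \bar R := (e / (2 ^ (pickle p).+1)%:R)%:E.
have [G HG] : exists G : J -> set T, forall p, D p ->
    F p `<=` \bigcup_(q in G p) S q /\
    \esum_(q in G p) w q <= cover_content (F p) + ep p.
  have H p : exists Gp : set T, D p -> F p `<=` \bigcup_(q in Gp) S q /\
    \esum_(q in Gp) w q <= cover_content (F p) + ep p.
    have [Dp|nDp] := pselect (D p); last by exists set0.
    have cfin : cover_content (F p) \is a fin_num.
      rewrite ge0_fin_numE ?cover_content_ge0// ltey.
      by apply/eqP => cpoo; apply: fin; exists p.
    have : cover_content (F p) < cover_content (F p) + ep p.
      by rewrite lteDl// lte_fin divr_gt0// ltr0n expn_gt0.
    by move/cover_content_lt => [Gp [FG Gw]]; exists Gp => _; split => //; exact: ltW.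
  by have [G HG] := boolp.choice H; exists G.
apply: (@le_trans _ _ (\esum_(q in \bigcup_(p in D) G p) w q)).
  apply: cover_content_le => x /EF[p Dp /(HG p Dp).1[q Gq Sq]].
  by exists q => //; exists p.
apply: (le_trans (esum_bigcup_le _ _ _)) => //.
apply: (@le_trans _ _ (\esum_(p in D) (cover_content (F p) + ep p))).
  by apply: le_esum => p Dp; exact: (HG p Dp).2.
rewrite esumD.
- by rewrite leeD2l//; exact/esum_halves_le/ltW.
- by move=> p _; exact: cover_content_ge0.
- by move=> p _; rewrite lee_fin divr_ge0// ltW.
Qed.

Lemma cover_content_bigcup0 (J : countType) (F : J -> set X) E :
  E `<=` \bigcup_p F p -> (forall p, cover_content (F p) = 0) ->
  cover_content E = 0.
Proof.
move=> EF F0; apply/le_anti; rewrite cover_content_ge0 andbT.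
by apply: le_trans (cover_content_bigcup EF) _; rewrite esum1.
Qed.

Lemma cover_content_sum (I : finType) (F : I -> set X) G :
  G `<=` \bigcup_i F i -> cover_content G <= \sum_(i : I) cover_content (F i).
Proof.
move=> GF; apply: (le_trans (cover_content_bigcup GF)).
have -> : [set: I] = [set` index_enum I].
  by apply/seteqP; split => i //= _; rewrite mem_index_enum.
rewrite esum_fset//; last by move=> i _; exact: cover_content_ge0.
by rewrite -fsbig_seq// index_enum_uniq.
Qed.

End CoverContent.

Arguments cover_content_ge0 {R T X w S} w0 E.
Arguments cover_content_cell {R T X w S} w0 p {E} ES.
Arguments cover_content0 {R T X w S} w0.
Arguments cover_content_bigcup {R T X w S} w0 {J D F E} EF.
Arguments cover_content_bigcup0 {R T X w S} w0 {J F E} EF F0.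
Arguments cover_content_sum {R T X w S} w0 {I F G} GF.

(** * The content built from [b]-adic cells *)

Lemma lee_sum_sub_seq (R : realType) (T : eqType) (s1 s2 : seq T)
    (f : T -> \bar R) : uniq s1 -> {subset s1 <= s2} ->
  (forall x, 0 <= f x)%E -> (\sum_(x <- s1) f x <= \sum_(x <- s2) f x)%E.
Proof.
move=> + + f0; elim: s1 s2 => [|x s1 IH] s2 /=.
  by move=> _ _; rewrite big_nil sume_ge0.
move=> /andP[xs1 us1] s12.
rewrite big_cons [leRHS](big_rem x) ?s12 ?mem_head//= leeD2l// IH// => y ys1.
have yx : y != x by apply: contraNneq xs1 => <-.
have := perm_to_rem (s12 x (mem_head _ _)).
by move=> /perm_mem/(_ y); rewrite s12 ?in_cons ?ys1 ?orbT// (negbTE yx).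
Qed.

Section Cells.
Context {R : realType} {n : nat}.
Variable b : nat.
Hypothesis b_gt0 : (0 < b)%N.
Implicit Types (x y : 'rV[R]_n) (z : 'rV[int]_n).

(** Cells are the fibres of this map. They are half-open, so that each level is a
    partition of the space and refines the previous one. *)
Definition key (j : nat) x : 'rV[int]_n :=
  \row_i Num.floor (b%:R ^+ j * x ord0 i).

Definition cell (p : nat * 'rV[int]_n) : set 'rV[R]_n :=
  [set x | key p.1 x = p.2].

Definition child z (d : 'rV['I_b]_n) : 'rV[int]_n :=
  \row_i (b%:Z * z ord0 i + (d ord0 i)%:Z).

Lemma key_child j x z d : key j.+1 x = child z d -> key j x = z.
Proof.
move=> /rowP kx; apply/rowP => i; have := kx i; rewrite !mxE => kxi.
have /andP[] := floor_itv (b%:R ^+ j.+1 * x ord0 i); rewrite kxi.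
have b0 : (0 : R) < b%:R by rewrite ltr0n.
rewrite exprS -mulrA; set u := _ * x ord0 i.
rewrite !rmorphD rmorphM/= rmorph1 -[b%:Z%:~R]/(b%:R).
rewrite -[(d ord0 i)%:Z%:~R]/((d ord0 i)%:R) => lo hi.
have dlt : (d ord0 i)%:R + 1 <= b%:R :> R by rewrite natr1 ler_nat ltn_ord.
have d0 : 0 <= (d ord0 i)%:R :> R by rewrite ler0n.
apply/floor_def; rewrite rmorphD/= rmorph1 -(ler_pM2l b0) -[X in _ && X](ltr_pM2l b0).
apply/andP; split; first by apply: le_trans lo; rewrite lerDl.
by apply: (lt_le_trans hi); rewrite mulrDr mulr1 -addrA lerD2l.
Qed.

Lemma key_has_child j x : exists d, key j.+1 x = child (key j x) d.
Proof.
have b0 : (0 : R) < b%:R by rewrite ltr0n.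
pose u i := b%:R ^+ j * x ord0 i.
pose e i : int := Num.floor (b%:R * u i) - b%:Z * Num.floor (u i).
have e0 i : 0 <= e i.
  rewrite subr_ge0 floor_ge_int rmorphM/= ler_pM2l//; exact: ge_floor.
have eb i : e i < b.
  rewrite ltrBlDl -{2}[b%:Z]mulr1 -mulrDr floor_lt_int rmorphM/= ltr_pM2l//.
  exact: floorD1_gt.
have He i : (`|e i| < b)%N by have := eb i; have := e0 i; lia.
exists (\row_i Ordinal (He i)); apply/rowP => i; rewrite !mxE/= gez0_abs//.
by rewrite /e exprS -mulrA -/(u i) addrC subrK.
Qed.

Lemma key_nested i k x y : (i <= k)%N -> key k x = key k y -> key i x = key i y.
Proof.
move=> /subnK <-; elim: (k - i)%N => [//|m IH]; rewrite addSn => kxy.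
apply: IH; have [d dy] := key_has_child (m + i) y.
by apply: (@key_child _ _ _ d); rewrite kxy.
Qed.

Lemma child_inj z : injective (child z).
Proof.
move=> d d' /rowP dd; apply/rowP => i; have := dd i; rewrite !mxE => /addrI[].
exact: val_inj.
Qed.

Section Content.
Variable beta : R.
Hypothesis beta01 : 0 < beta < 1.
Local Open Scope ereal_scope.

(** With [beta = b `^ (- t)], a cell is charged its side to the power [t]. *)
Definition cell_weight (p : nat * 'rV[int]_n) : \bar R := (beta ^+ p.1)%:E.

Definition content : set 'rV[R]_n -> \bar R := cover_content cell_weight cell.

Lemma cell_weight_ge0 p : 0 <= cell_weight p.
Proof. by rewrite lee_fin exprn_ge0//; case/andP: beta01 => /ltW. Qed.
Local Notation w0 := cell_weight_ge0.

Lemma le_content E F : E `<=` F -> content E <= content F.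
Proof. exact: le_cover_content. Qed.

Lemma content_ge0 E : 0 <= content E.
Proof. exact: cover_content_ge0 w0 E. Qed.

Lemma content_cell p E : content (E `&` cell p) <= (beta ^+ p.1)%:E.
Proof. by apply: (cover_content_cell w0 p) => x []. Qed.

Lemma content_cell_fin p E : content (E `&` cell p) \is a fin_num.
Proof.
rewrite ge0_fin_numE ?content_ge0//; apply: le_lt_trans (content_cell p E) _.
exact: ltry.
Qed.

Lemma contentU E F G : G `<=` E `|` F -> content G <= content E + content F.
Proof.
move=> GEF; have H : G `<=` \bigcup_(c : bool) (if c then E else F).
  by move=> x /GEF[Ex|Fx]; [exists true|exists false].
by have := cover_content_sum (S := cell) w0 H; rewrite big_bool.
Qed.

Lemma content_children_ge E j z : content (E `&` cell (j, z)) <=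
  \sum_(d : 'rV['I_b]_n) content (E `&` cell (j.+1, child z d)).
Proof.
apply: (cover_content_sum w0) => x [Ex /= xz].
by have [d dx] := key_has_child j x; exists d => //; split => //; rewrite /cell/= dx xz.
Qed.

(** A covering of [E] inside a cell that is cheaper than the cell itself uses
    only strictly smaller cells, and these are sorted by the child that contains
    them: below saturation, the content is additive over the children. *)
Lemma content_children_le E j z : content (E `&` cell (j, z)) < (beta ^+ j)%:E ->
  \sum_(d : 'rV['I_b]_n) content (E `&` cell (j.+1, child z d)) <=
  content (E `&` cell (j, z)).
Proof.
move=> clt; apply/lee_addgt0Pr => e e0.
set c := content (E `&` cell (j, z)) in clt *.
have : c < Order.min (beta ^+ j)%:E (c + e%:E).
  by rewrite lt_min clt lteDl ?content_cell_fin// lte_fin.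
move=> /cover_content_lt[D [ED]]; rewrite lt_min => /andP[Dj Dc].
pose J (d : 'rV['I_b]_n) : set (nat * 'rV[int]_n) :=
  [set p | (j < p.1)%N /\ exists2 x, cell p x & key j.+1 x = child z d].
have JI d d' p : J d p -> J d' p -> d = d'.
  move=> [jp [x px xd]] [_ [y py yd]]; apply: (@child_inj z).
  rewrite -xd -yd; apply: (key_nested jp).
  by rewrite [LHS]px [RHS]py.
apply: (@le_trans _ _ (\sum_(d : 'rV['I_b]_n)
    \esum_(p in D `&` J d) cell_weight p)); last first.
  under eq_bigr do rewrite esum_mkcondr.
  rewrite -esum_sum; last by move=> p d _ _; case: ifP => // _; exact: w0.
  apply: le_trans (ltW Dc); apply: le_esum => p Dp.
  have [[d0 Jd0]|nJ] := pselect (exists d, J d p); last first.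
    rewrite big1 ?w0// => d _; rewrite ifF//; apply/negP; rewrite inE => Jd.
    by apply: nJ; exists d.
  rewrite (bigD1 d0)//= big1 ?adde0; first by case: ifP => // _; exact: w0.
  move=> d dd0; rewrite ifF//; apply/negP; rewrite inE => Jd.
  by move/eqP: dd0; apply; exact: JI Jd Jd0.
apply: lee_sum => d _; apply: cover_content_le => x [Ex xd].
have xz : cell (j, z) x by exact: key_child xd.
have [p Dp px] := ED x (conj Ex xz); exists p => //; split => //.
split; last by exists x.
rewrite ltnNge; apply/negP => pj.
have : cell_weight p <= \esum_(q in D) cell_weight q.
  exact: (esum_le_term w0).
apply/negP; rewrite -ltNge; apply: (lt_le_trans Dj).
rewrite lee_fin; case/andP: beta01 => b0 b1.
by apply: ler_wiXn2l => //; exact: ltW.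
Qed.

(** Density: where [E] fills no small cell beyond the ratio [theta], it is
    null, since each covering can be refined at a geometric gain. *)
Lemma content_sparse0 E (theta : R) j0 p : (0 < theta < 1)%R -> (j0 <= p.1)%N ->
  content ([set x | E x /\ forall j, (j0 <= j)%N ->
     content (E `&` cell (j, key j x)) < (theta * beta ^+ j)%:E] `&` cell p) = 0.
Proof.
move=> /andP[t0 t1] j0p; set Z := [set x | _].
case/andP: (beta01) => b0 b1.
have H m : forall q, (j0 <= q.1)%N ->
    content (Z `&` cell q) <= (theta ^+ m * beta ^+ q.1)%:E.
  elim: m => [|m IH] q jq; first by rewrite mul1r content_cell.
  have [[x [Zx qx]]|nZ] := pselect (exists x, Z x /\ cell q x); last first.
    rewrite (_ : _ `&` _ = set0); last first.
      by apply/nonemptyPn => -[x [Zx qx]]; apply: nZ; exists x.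
    by rewrite /content (cover_content0 w0) lee_fin ?mulr_ge0 ?exprn_ge0 ?ltW//.
  have [Ex /(_ q.1 jq)] := Zx.
  rewrite (_ : (q.1, _) = q); last by rewrite [key _ _]qx; case: (q).
  move=> /cover_content_lt[D [ED Dlt]].
  apply: (@le_trans _ _ (\esum_(r in D) content (Z `&` cell r))).
    apply: (cover_content_bigcup w0) => y [[Ey Zy] qy].
    by have [r Dr ry] := ED y (conj Ey qy); exists r.
  rewrite exprSr -mulrA.
  apply: (@le_trans _ _ (\esum_(r in D) ((theta ^+ m)%:E * cell_weight r))).
    apply: le_esum => r Dr; rewrite -EFinM; apply: IH.
    apply: (leq_trans jq); rewrite leqNgt; apply/negP => rq.
    have : cell_weight r <= \esum_(q in D) cell_weight q.
      exact: (esum_le_term w0).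
    apply/negP; rewrite -ltNge; apply: (lt_le_trans Dlt); rewrite lee_fin.
    apply: (@le_trans _ _ (beta ^+ q.1)%R).
      by rewrite ler_piMl ?exprn_ge0// ltW.
    by apply: ler_wiXn2l; [exact: ltW|exact: ltW|exact: ltnW].
  apply: esumZ_le; [by rewrite exprn_ge0// ltW| |exact: w0].
  exact: ltW.
apply/le_anti; rewrite content_ge0 andbT; apply/lee_addgt0Pr => e e0.
rewrite add0e.
have [m hm] : exists m, (theta ^+ m < e)%R.
  have : (theta ^+ m @[m --> \oo] --> (0:R))%R.
    by apply: cvg_expr; rewrite ger0_norm ?ltW.
  move=> /cvgrPdist_lt/(_ e e0)[m _ /(_ m (leqnn _))].
  by rewrite sub0r normrN ger0_norm ?exprn_ge0 ?ltW// => ?; exists m.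
apply: (le_trans (H m p j0p)); rewrite lee_fin.
apply: (@le_trans _ _ (theta ^+ m)%R); last exact: ltW.
by rewrite ler_piMr ?exprn_ge0 ?exprn_ile1// ltW.
Qed.

Section StoppingTree.
Variable stop : nat * 'rV[int]_n -> Prop.

(** A stopping time on the tree of cells below [p], cut off at depth [d] so as to
    remain a finite list. *)
Fixpoint stopped d (p : nat * 'rV[int]_n) : seq (nat * 'rV[int]_n) :=
  if d is d'.+1 then
    if `[< stop p >] then [:: p] else
    flatten [seq stopped d' (p.1.+1, child p.2 e) | e <- enum 'rV['I_b]_n]
  else [::].

Lemma stopped_subset d d' p : (d <= d')%N ->
  {subset stopped d p <= stopped d' p}.
Proof.
elim: d d' p => [//|d IH] [//|d'] p dd' q /=.
case: ifP => // _ /flatten_mapP[e eE qe]; apply/flatten_mapP; exists e => //.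
exact: IH qe.
Qed.

Lemma stopped_cover d p x : cell p x -> stop ((p.1 + d)%N, key (p.1 + d) x) ->
  exists2 q, q \in stopped d.+1 p & cell q x.
Proof.
elim: d p => [|d IH] p px.
  rewrite addn0 (_ : (_, _) = p); last by rewrite [key _ _]px; case: (p).
  by move=> sp; exists p => //=; rewrite asboolT// mem_head.
move=> sp; rewrite /= -/(stopped d.+1); case: ifP => [_|_].
  by exists p => //; rewrite mem_head.
have [e ex] := key_has_child p.1 x.
have /IH : cell (p.1.+1, child p.2 e) x by rewrite /cell/= ex [key _ _]px.
rewrite /= addSnnS => /(_ sp)[q qs qx]; exists q => //.
by apply/flatten_mapP; exists e => //; rewrite mem_enum.
Qed.

End StoppingTree.

(** This makes the content a capacity. Stop at the first cells that some [E k]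
    fills up to the ratio [theta]. Above them the content is additive by
    [content_children_le], so that together they are charged at most
    [gamma / theta]; what they miss is null by [content_sparse0]. *)
Lemma content_increasing (E : nat -> set 'rV[R]_n) (gamma : \bar R) p :
  {homo E : k l / (k <= l)%N >-> k `<=` l} ->
  (forall k, content (E k `&` cell p) <= gamma) ->
  content (\bigcup_k E k `&` cell p) <= gamma.
Proof.
move=> Einc Eg; apply/lee_mul01Pr; first exact: content_ge0.
move=> theta /andP[t0 t1]; case/andP: (beta01) => b0 b1.
pose stop q := exists k, (theta * beta ^+ q.1)%:E <= content (E k `&` cell q).
have Hd d : forall q, exists k0, forall k, (k0 <= k)%N ->
    theta%:E * (\sum_(r <- stopped stop d q) cell_weight r) <=
    content (E k `&` cell q).
  elim: d => [|d IH] q /=.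
    by exists 0%N => k _; rewrite big_nil mule0 content_ge0.
  case: ifPn => [/asboolP[k0 hk0]|/asboolPn nst].
    exists k0 => k kk0; rewrite big_seq1 -EFinM; apply: (le_trans hk0).
    by apply: le_content; apply: setSI; exact: Einc.
  have [K HK] := boolp.choice (fun e : 'rV['I_b]_n =>
    IH (q.1.+1, child q.2 e)).
  exists (\max_e K e)%N => k kK.
  rewrite big_flatten/= big_map big_enum/=.
  rewrite ge0_sume_distrr; last by move=> e _; rewrite sume_ge0// => *; exact: w0.
  apply: (@le_trans _ _ (\sum_e content (E k `&` cell (q.1.+1, child q.2 e)))).
    apply: lee_sum => e _; apply: HK; apply: leq_trans kK.
    exact: leq_bigmax.
  rewrite [X in _ `&` cell X]surjective_pairing; apply: content_children_le.
  rewrite -surjective_pairing ltNge; apply/negP => hq; apply: nst; exists k.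
  by apply: le_trans hq; rewrite lee_fin ler_piMl ?exprn_ge0 ?ltW.
pose D : set (nat * 'rV[int]_n) := [set q | exists d, q \in stopped stop d p].
pose Z k := [set x | E k x /\ forall j, (p.1 <= j)%N ->
     content (E k `&` cell (j, key j x)) < (theta * beta ^+ j)%:E] `&` cell p.
have cZ : content (\bigcup_k Z k) = 0.
  apply: (cover_content_bigcup0 w0 (F := Z)) => // k.
  by apply: content_sparse0 => //; rewrite t0.
have cD : theta%:E * (\esum_(q in D) cell_weight q) <= gamma.
  rewrite -lee_pdivlMl//; apply: ge_ereal_sup => _ [F [finF FD] <-].
  rewrite lee_pdivlMl//.
  have [d Fd] : exists d, F `<=` [set` stopped stop d p].
    have [g Hg] : exists g, forall q, F q -> q \in stopped stop (g q) p.
      have H q : exists d, F q -> q \in stopped stop d p.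
        have [/FD[d dq]|nF] := pselect (F q); first by exists d.
        by exists 0%N.
      by have [g Hg] := boolp.choice H; exists g.
    exists (\max_(q <- enum_fset (fset_set F)) g q)%N => q Fq /=.
    apply: stopped_subset (Hg q Fq).
    by apply: leq_bigmax_seq => //; rewrite in_fset_set// inE.
  have [k0 /(_ k0 (leqnn _)) hk0] := Hd d p.
  apply: le_trans (Eg k0); apply: le_trans hk0.
  apply: lee_wpmul2l; first by rewrite lee_fin ltW.
  rewrite fsbig_finite//=; apply: lee_sum_sub_seq.
  - exact: fset_uniq.
  - by move=> q; rewrite in_fset_set// inE => /Fd.
  - exact: w0.
have cU : content (\bigcup_k E k `&` cell p) <= \esum_(q in D) cell_weight q.
  apply: (@le_trans _ _ (content (\bigcup_(q in D) cell q) +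
      content (\bigcup_k Z k))); last first.
    by rewrite cZ adde0; exact: cover_content_le.
  apply: contentU => x [[k _ Ekx] px].
  have [[j [pj sj]]|ns] :=
      pselect (exists j, (p.1 <= j)%N /\ stop (j, key j x)).
    left; rewrite -(subnKC pj) in sj.
    by have [q qs qx] := stopped_cover px sj; exists q => //; eexists; exact: qs.
  right; exists k => //; split => //; split => // j pj.
  by rewrite ltNge; apply/negP => hj; apply: ns; exists j; split => //; exists k.
by apply: le_trans cD; apply: lee_wpmul2l => //; rewrite lee_fin ltW.
Qed.

End Content.
End Cells.

(** * Analytic sets *)

Section Norms.
Context {R : realType} {n : nat}.
Implicit Types (x y : 'rV[R]_n).

Lemma coord_le_norm x i : `|x ord0 i| <= `|x|.
Proof.
rewrite [leRHS]/Num.norm /= mx_normrE.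
by apply/bigmax_geP; right => /=; exists (ord0, i).
Qed.

Lemma norm_le_coord x r : 0 <= r -> (forall i, `|x ord0 i| <= r) -> `|x| <= r.
Proof.
move=> r0 xr; rewrite [leLHS]/Num.norm /= mx_normrE.
by apply/bigmax_leP; split => //= -[i j] _ /=; rewrite ord1.
Qed.

Lemma norm_lt_coord x r : 0 < r -> (forall i, `|x ord0 i| < r) -> `|x| < r.
Proof.
move=> r0 xr; rewrite [ltLHS]/Num.norm /= mx_normrE.
by apply/bigmax_ltP; split => //= -[i j] _ /=; rewrite ord1.
Qed.

Lemma ball_rVE x r : ball x r = [set y | `|x - y| < r].
Proof. by rewrite -ball_normE. Qed.

Lemma ball_subl x y u e : ball y e u -> ball (x - y) e (x - u).
Proof.
rewrite !ball_rVE /= (_ : x - y - (x - u) = u - y); last first.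
  by apply/rowP => i; rewrite !mxE; ring.
by rewrite -normrN opprB.
Qed.

End Norms.

Section Analytic.
Context {X : topologicalType}.
Implicit Types (A : set X) (C : nat -> (nat -> nat) -> set X).

(** The result of Suslin's operation: [A] is the projection of a closed subset
    of the product of the Baire space with [X]. *)
Definition suslin_scheme C :=
  (forall k sg, closed (C k sg)) /\
  (forall k sg, exists m, forall ta : nat -> nat,
     (forall i, (i < m)%N -> ta i = sg i) -> C k ta = C k sg).

Definition analytic A :=
  exists2 C, suslin_scheme C & A = [set x | exists sg, forall k, C k sg x].

Lemma closed_analytic A : closed A -> analytic A.
Proof.
move=> Acl; exists (fun _ _ => A); first by split => // k sg; exists 0%N.
apply/seteqP; split => [x Ax|x [sg /(_ 0%N)//]].
by exists (fun=> 0%N).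
Qed.

Lemma analytic_bigcup (A : nat -> set X) :
  (forall i, analytic (A i)) -> analytic (\bigcup_i A i).
Proof.
move=> /(_ _)/cid2 anA.
pose C i := projT1 (anA i).
have CS i : suslin_scheme (C i) by rewrite /C; case: (anA i).
have CA i : A i = [set x | exists sg, forall k, C i k sg x].
  by rewrite /C; case: (anA i).
exists (fun k sg => C (sg 0%N) k (sg \o S)).
  split=> [k sg|k sg]; first exact: (CS _).1.
  have [m Hm] := (CS (sg 0%N)).2 k (sg \o S).
  exists m.+1 => ta tasg; rewrite tasg//; apply: Hm => i im /=.
  by rewrite tasg.
apply/seteqP; split => [x [i _]|x [sg Hsg]].
  rewrite CA => -[sg Hsg].
  by exists (fun l => if l is l'.+1 then sg l' else i) => k; exact: Hsg.
by exists (sg 0%N) => //; rewrite CA; exists (sg \o S).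
Qed.

(** A sequence of branches is coded in a single one by pairing. *)
Lemma analytic_bigcap (A : nat -> set X) :
  (forall i, analytic (A i)) -> analytic (\bigcap_i A i).
Proof.
move=> /(_ _)/cid2 anA.
pose C i := projT1 (anA i).
have CS i : suslin_scheme (C i) by rewrite /C; case: (anA i).
have CA i : A i = [set x | exists sg, forall k, C i k sg x].
  by rewrite /C; case: (anA i).
pose branch (sg : nat -> nat) (i l : nat) := sg (pickle (i, l)).
exists (fun q sg => if @unpickle (nat * nat)%type q is Some (i, k)
                    then C i k (branch sg i) else setT).
  split=> q sg; case: (unpickle q) => [[i k]|].
  - exact: (CS i).1.
  - exact: closedT.
  - have [m Hm] := (CS i).2 k (branch sg i).
    exists (\max_(l < m) (pickle (i, nat_of_ord l)).+1)%N => ta tasg.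
    apply: Hm => l lm; apply: tasg.
    exact: (leq_bigmax (Ordinal lm)).
  - by exists 0%N.
apply/seteqP; split => [x Ax|x [sg Hsg] i _]; last first.
  by rewrite CA; exists (branch sg i) => k; have := Hsg (pickle (i, k)); rewrite pickleK.
have H i : exists sg, forall k, C i k sg x by have := Ax i I; rewrite CA.
have [f Hf] := boolp.choice H.
exists (fun q => if @unpickle (nat * nat)%type q is Some (i, l) then f i l else 0%N).
move=> q; case: (unpickle q) => [[i k]|//].
rewrite (_ : branch _ i = f i); first exact: Hf.
by apply/funext => l; rewrite /branch pickleK.
Qed.

End Analytic.

Section BorelAnalytic.
Context {R : realType} {n : nat}.

Lemma open_bigcup_closed (U : set 'rV[R]_n) : open U ->
  exists2 F : nat -> set 'rV[R]_n, (forall k, closed (F k)) & U = \bigcup_k F k.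
Proof.
move=> Uop; exists (fun k => ~` \bigcup_(y in ~` U) ball y (k.+1%:R^-1 : R)).
  move=> k; apply: open_closedC; apply: bigcup_open => y _; exact: ball_open.
apply/seteqP; split => [x Ux|x [k _ Hx]]; last first.
  apply: contrapT => nUx; apply: Hx; exists x => //; exact: ballxx.
have /nbhs_ballP[e /= e0 xe] : nbhs x U by exact: open_nbhs_nbhs.
have [k ke] : exists k, k.+1%:R^-1 < e.
  have [k _ Hk] := near_infty_natSinv_lt (PosNum e0); exists k.
    exact: (Hk k (leqnn k)).
exists k => // -[y nUy /ball_sym yx]; apply: nUy; apply: xe.
exact: le_ball (ltW ke) _ yx.
Qed.

(** The sets that are analytic together with their complements form a
    sigma-algebra, and open sets are among them. *)
Lemma borel_analytic (A : set 'rV[R]_n) : borel A -> analytic A.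
Proof.
pose S := [set A : set 'rV[R]_n | analytic A /\ analytic (~` A)].
suff : <<s [set U : set 'rV[R]_n | open U] >> `<=` S by move=> H /H[].
apply: smallest_sub.
  split.
  - split; first exact/closed_analytic/closed0.
    by rewrite setC0; exact/closed_analytic/closedT.
  - by move=> B [aB aCB]; split; rewrite setTD// setCK.
  - move=> F SF; split; first by apply: analytic_bigcup => i; exact: (SF i).1.
    by rewrite setC_bigcup; apply: analytic_bigcap => i; exact: (SF i).2.
move=> U /= Uop; split; last exact/closed_analytic/open_closedC.
have [F Fcl ->] := open_bigcup_closed Uop.
by apply: analytic_bigcup => i; exact: closed_analytic.
Qed.

End BorelAnalytic.

(** * Compact subsets of positive content *)

Section BoundedBranches.
Context {R : realType} {n : nat}.
Implicit Types (x : 'rV[R]_n) (z : 'rV[int]_n).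

Definition int_vector z : 'rV[R]_n := \row_i (z ord0 i)%:~R.

Definition cube x e : set 'rV[R]_n :=
  [set y | forall i, x ord0 i <= y ord0 i <= x ord0 i + e].

Lemma compact_cube x e : compact (cube x e).
Proof.
rewrite (_ : cube x e = [set y : 'rV[R]_n | forall i,
    `[x ord0 i, x ord0 i + e]%classic (y ord0 i)]).
  have := @rV_compact R _ (fun i => `[x ord0 i, x ord0 i + e]%classic).
  by apply => i; exact: segment_compact.
by apply/seteqP; split => y xy i; have := xy i; rewrite /= in_itv.
Qed.

Lemma cell0_cube b z : cell b (0%N, z) `<=` cube (int_vector z) 1.
Proof.
move=> x /rowP xz i; have := floor_itv (x ord0 i).
have := xz i; rewrite !mxE/= expr0 mul1r => ->.
by rewrite rmorphD/= => /andP[-> /ltW].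
Qed.

Section BranchLimit.
Variables (C : nat -> (nat -> nat) -> set 'rV[R]_n) (N : nat -> nat).
Hypothesis CS : suslin_scheme C.
Variable Q : set 'rV[R]_n.
Hypothesis Qco : compact Q.

Lemma ultra_bounded_const (I : Type) (F : set_system I) (f : I -> nat) M :
  UltraFilter F -> F [set t | (f t <= M)%N] ->
  exists2 v, (v <= M)%N & F [set t | f t = v].
Proof.
move=> FU; elim: M => [|M IH] FM.
  exists 0%N => //; apply: filterS FM => t /=; rewrite leqn0 => /eqP //.
have [FM1|FnM1] := in_ultra_setVsetC [set t | f t = M.+1] FU.
  by exists M.+1.
have [|v vM Fv] := IH; last by exists v => //; exact: leqW.
apply: filterS (filterI FM FnM1) => t [/= fM fnM].
by rewrite -ltnS ltn_neqAle fM andbT; apply/eqP.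
Qed.

(** Branches bounded by [N] form a compact set: points lying on such branches
    up to an ultrafilter converge to a point on such a branch. *)
Lemma branch_limit (I : Type) (F : set_system I) (f : I -> 'rV[R]_n)
    (sg : I -> nat -> nat) : UltraFilter F ->
  F [set t | Q (f t)] -> (forall i, F [set t | (sg t i <= N i)%N]) ->
  F [set t | forall k, C k (sg t) (f t)] ->
  exists x, [/\ Q x, f @ F --> x &
    exists sg', (forall i, (sg' i <= N i)%N) /\ forall k, C k sg' x].
Proof.
move=> FU FQ FN FC.
have [x [Qx fx]] : Q `&` [set x | f @ F --> x] !=set0.
    have [//|x [Qx clx]] := Qco (F := f @ F) _.
  exists x; split => // U Ux.
  have [//|FnU] := in_ultra_setVsetC (f @^-1` U) FU.
  have [y [/= Uy nUy]] := clx (~` U) U FnU Ux.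
  by case: Uy.
exists x; split => //.
have H i : exists v, (v <= N i)%N /\ F [set t | sg t i = v].
  by have [v vN Fv] := ultra_bounded_const FU (FN i); exists v.
have [sg' Hsg'] := boolp.choice H.
exists sg'; split => [i|k]; first exact: (Hsg' i).1.
have [m Hm] := CS.2 k sg'.
have agree : F [set t | forall i, (i < m)%N -> sg t i = sg' i].
  elim: m {Hm} => [|m IH]; first by apply: filterS filterT => t _ i.
  apply: filterS (filterI IH (Hsg' m).2) => t [/= Ht tm] i.
  by rewrite ltnS leq_eqVlt => /predU1P[->//|]; exact: Ht.
have FCk : F [set t | C k sg' (f t)].
  apply: filterS (filterI agree FC) => t [/= Ht Ct].
  by rewrite /= -(Hm (sg t)).
have clC := CS.1 k sg'; apply: clC => U Ux.
have FU' : F [set t | U (f t)] by exact: (fx U Ux).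
have [t [Ct Ut]] := filter_ex (filterI FCk FU').
by exists (f t).
Qed.

End BranchLimit.
End BoundedBranches.

Section Capacitability.
Context {R : realType} {n : nat}.
Variable b : nat.
Hypothesis b_gt0 : (0 < b)%N.
Variable beta : R.
Hypothesis beta01 : 0 < beta < 1.
Implicit Types (z : 'rV[int]_n).
Local Notation content := (@content R n b beta).
Local Notation w0 := (@cell_weight_ge0 R n beta beta01).

Definition neighbour z (d : 'rV['I_3]_n) : 'rV[int]_n :=
  \row_i (z ord0 i + (d ord0 i)%:Z - 1).

Lemma neighbour_nbhs p (x : 'rV[R]_n) : cell b p x ->
  nbhs x (\bigcup_d cell b (p.1, neighbour p.2 d)).
Proof.
have b0 : (0 : R) < b%:R ^+ p.1 by rewrite exprn_gt0// ltr0n.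
move=> /rowP px; apply/nbhs_ballP; exists (b%:R ^+ p.1)^-1.
  by rewrite /= invr_gt0.
move=> y; rewrite ball_rVE/= => xy.
have H i : exists d : 'I_3, Num.floor (b%:R ^+ p.1 * y ord0 i) =
    (p.2 ord0 i + d%:Z - 1).
  have := px i; rewrite !mxE => <-.
  have : `|x ord0 i - y ord0 i| < (b%:R ^+ p.1)^-1.
    by apply: le_lt_trans xy; have := coord_le_norm (x - y) i; rewrite !mxE.
  rewrite -(ltr_pM2l b0) mulfV ?gt_eqF// -{1}[b%:R ^+ _]gtr0_norm// -normrM mulrBr.
  set u := _ * x _ _; set v := _ * y _ _; rewrite ltr_norml => /andP[h1 h2].
  have /andP[u1 u2] := floor_itv u; have /andP[v1 v2] := floor_itv v.
  rewrite !rmorphD !rmorph1 in u2 v2.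
  have a1 : Num.floor u < Num.floor v + 2%:Z by rewrite -(ltr_int R) rmorphD/=; lra.
  have a2 : Num.floor v < Num.floor u + 2%:Z by rewrite -(ltr_int R) rmorphD/=; lra.
  have He : (absz (Num.floor v - Num.floor u + 1)%R < 3)%N.
    by clear -a1 a2; lia.
  exists (Ordinal He) => /=; clear -a1.
  by rewrite gez0_abs; lia.
have [d Hd] := boolp.choice H.
exists (\row_i d i) => //; apply/rowP => i; rewrite !mxE.
exact: Hd.
Qed.

(** Enlarging half-open cells to neighbourhoods of themselves multiplies the
    content by at most the number [3 ^ n] of neighbours. *)
Lemma content_neighbours (D : set (nat * 'rV[int]_n)) (M : R) :
  (\esum_(p in D) cell_weight beta p <= M%:E)%E ->
  (content (\bigcup_(p in D) \bigcup_d cell b (p.1, neighbour p.2 d))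
    <= (#|{: 'rV['I_3]_n}|%:R * M)%:E)%E.
Proof.
move=> DM; apply: (le_trans (cover_content_bigcup w0 (fun x h => h))).
apply: (@le_trans _ _ (\esum_(p in D)
    ((#|{: 'rV['I_3]_n}|%:R)%:E * cell_weight beta p))%E).
  apply: le_esum => p Dp.
  apply: (le_trans (cover_content_sum w0 (fun x h => h))).
  apply: (@le_trans _ _ (\sum_(d : 'rV['I_3]_n) cell_weight beta p)%E).
    apply: lee_sum => d _.
    exact: (cover_content_cell w0 (p.1, neighbour p.2 d)).
  by rewrite sumEFin -EFinM sumr_const mulr_natl.
by apply: esumZ_le => //; exact: w0.
Qed.

(** Choquet's capacitability theorem for the content. The branches of the scheme
    are bounded one coordinate after the other, each time losing as little content
    as desired since the content is continuous along increasing sequences. The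
    points lying on the bounded branches form a compact set [K]; a neighbourhood of
    [K] contains one of the sets met in the process, hence has large content. *)
Theorem analytic_compact_content (A : set 'rV[R]_n) z : analytic A ->
  (0 < content (A `&` cell b (0%N, z)))%E ->
  exists K, [/\ compact K, K `<=` A & (0 < content K)%E].
Proof.
move=> [C CS AE] c0.
pose Q := cube (int_vector z : 'rV[R]_n) 1.
have Qco : compact Q by exact: compact_cube.
pose As (s : seq nat) : set 'rV[R]_n := [set x | Q x /\ exists sg,
  (forall i, (i < size s)%N -> (sg i <= nth 0 s i)%N) /\ forall k, C k sg x].
pose cz (E : set 'rV[R]_n) := content (E `&` cell b (0%N, z)).
pose gamma := fine (cz A) / 2.
have czfin : cz A \is a fin_num by exact: content_cell_fin.
have g0 : 0 < gamma by rewrite divr_gt0// -lte_fin fineK.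
have gA : (gamma%:E < cz A)%E.
  rewrite -[ltRHS]fineK// lte_fin /gamma.
  have : 0 < fine (cz A) by rewrite -lte_fin fineK.
  by lra.
have P0 : (gamma%:E < cz (As [::]))%E.
  apply: (lt_le_trans gA); apply: le_content => x [Ax xz]; split => //.
  split; first exact: cell0_cube xz.
  by move: Ax; rewrite AE => -[sg Hsg]; exists sg.
have step s : exists M, (gamma%:E < cz (As s))%E ->
    (gamma%:E < cz (As (rcons s M)))%E.
  apply: contrapT => /forallNP H.
  have gs : (gamma%:E < cz (As s))%E by have /not_implyP[] := H 0%N.
  have : (cz (As s) <= gamma%:E)%E; last by rewrite leNgt gs.
  apply: (@le_trans _ _ (cz (\bigcup_M As (rcons s M)))).
    apply: le_content; apply: setSI => x [Qx [sg [sgs Csg]]].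
    exists (sg (size s)) => //; split => //; exists sg; split => // i.
    rewrite size_rcons ltnS nth_rcons leq_eqVlt => /predU1P[->|is_].
      by rewrite ltnn eqxx.
    by rewrite is_; exact: sgs.
  apply: content_increasing => //.
    move=> k l kl x [Qx [sg [sgs Csg]]]; split => //; exists sg; split => // i.
    move=> i1; apply: (leq_trans (sgs i _)).
      by move: i1; rewrite !size_rcons.
    by rewrite !nth_rcons; case: ifP => // _; case: ifP.
  move=> k; rewrite leNgt; apply/negP => hk.
  by have /not_implyP[_] := H k; apply.
have [f Hf] := boolp.choice step.
(* the successive bounds: [s_ k] lists those of the first [k] coordinates *)
pose s_ := fix s_ k := if k is k'.+1 then rcons (s_ k') (f (s_ k')) else [::].
pose N k := f (s_ k).
have sN k : s_ k = mkseq N k.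
  by elim: k => [//|k IH]; rewrite mkseqS -IH.
have Ps k : (gamma%:E < cz (As (s_ k)))%E by elim: k => [//|k IH]; exact: Hf.
pose K : set 'rV[R]_n := [set x | Q x /\ exists sg,
  (forall i, (sg i <= N i)%N) /\ forall k, C k sg x].
have KA : K `<=` A by move=> x [_ [sg [_ Csg]]]; rewrite AE; exists sg.
exists K; split => //.
  rewrite compact_ultra => F FU FK.
  have H x : exists sg : nat -> nat, K x ->
      (forall i, (sg i <= N i)%N) /\ forall k, C k sg x.
    have [[Qx [sg Hsg]]|nK] := pselect (K x); first by exists sg.
    by exists (fun=> 0%N).
  have [sg Hsg] := boolp.choice H.
  have [x [Qx Fx Hx]] : exists x, [/\ Q x, id @ F --> x & exists sg',
      (forall i, (sg' i <= N i)%N) /\ forall k, C k sg' x].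
    apply: (branch_limit CS Qco (sg := sg) FU).
    - by apply: filterS FK => x [].
    - by move=> i; apply: filterS FK => x /Hsg[+ _]; apply.
    - by apply: filterS FK => x /Hsg[_ +].
  by exists x; split.
apply: contrapT => /negP; rewrite -leNgt => cK0.
pose k3 : R := #|{: 'rV['I_3]_n}|%:R.
have k30 : 0 <= k3 by rewrite ler0n.
have : (content K < (gamma / (k3 + 1))%:E)%E.
  by apply: (le_lt_trans cK0); rewrite lte_fin divr_gt0// ltr_wpDl.
move=> /cover_content_lt[D [KD Dlt]].
pose O : set 'rV[R]_n := \bigcup_(p in D) \bigcup_d cell b (p.1, neighbour p.2 d).
have [k Hk] : exists k, As (s_ k) `<=` O.
  apply: contrapT => /forallNP H.
  have H' k : exists y : 'rV[R]_n * (nat -> nat), [/\ Q y.1, ~ O y.1,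
      (forall i, (i < k)%N -> (y.2 i <= N i)%N) & forall l, C l y.2 y.1].
    have /existsNP[x /not_implyP[[Qx [sg [sgs Csg]]] nOx]] := H k.
    exists (x, sg); split => //= i ik.
    by have := sgs i; rewrite sN size_mkseq nth_mkseq//; exact.
  have [y Hy] := boolp.choice H'.
  have [F [FU ooF]] := @ultraFilterLemma nat \oo _.
  have [x [Qx Fx Hx]] : exists x, [/\ Q x, (fst \o y) @ F --> x & exists sg',
      (forall i, (sg' i <= N i)%N) /\ forall k, C k sg' x].
    apply: (branch_limit CS Qco (sg := snd \o y) FU).
    - by apply: filterS filterT => k _; have [] := Hy k.
    - move=> i; apply: ooF; exists i.+1 => // k /= ik.
      by have [_ _ + _] := Hy k; apply.
    - by apply: filterS filterT => k _; have [] := Hy k.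
  have Kx : K x by [].
  have [p Dp px] := KD x Kx.
  have Ox : nbhs x O.
    apply: filterS (neighbour_nbhs px) => u [d _ ud].
    by exists p => //; exists d.
  have FO : F [set t | O (y t).1] by exact: (Fx O Ox).
  have [k Ok] := filter_ex FO.
  by have [_ + _ _] := Hy k; apply.
have : (gamma%:E < (k3 * (gamma / (k3 + 1)))%:E)%E.
  apply: (lt_le_trans (Ps k)).
  apply: (@le_trans _ _ (content O)).
    by apply: le_content => x [/Hk].
  by apply: content_neighbours; exact: ltW.
rewrite lte_fin mulrA ltr_pdivlMr ?ltr_wpDl//.
by rewrite mulrC; nra.
Qed.

End Capacitability.

(** * Thinning by conditional expectations *)

Section Sampling.
Context {R : realType}.

Lemma expRN_le_half (w : R) : 0 <= w <= 1 -> expR (- w) <= 1 - w / 2.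
Proof.
move=> /andP[w0 w1]; rewrite expRN invf_ple ?posrE ?expR_gt0//; last by lra.
apply: le_trans (expR_ge1Dx w).
rewrite -[leLHS]mul1r ler_pdivrMr; last by lra.
by nra.
Qed.

Lemma sampling_average (w p : R) : 0 <= w <= 1 -> 0 <= p <= 1 ->
  p * expR (p * w / 2 - w) + (1 - p) * expR (p * w / 2) <= 1.
Proof.
move=> w01 /andP[p0 p1]; rewrite expRD mulrCA mulrC -mulrDl.
have e0 := expR_gt0 (p * w / 2).
rewrite -ler_pdivlMr// mul1r -expRN.
have h1 := expRN_le_half w01; have h2 := expR_ge1Dx (- (p * w / 2)).
apply: le_trans h2; move: h1; set e := expR _ => h1.
have : p * e <= p * (1 - w / 2) by rewrite ler_wpM2l.
by lra.
Qed.

(** The left-hand side is the conditional expectation, given the choices made so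
    far, of a quantity to be kept small by a random subset of density [p];
    deciding each element of [U] in turn, one of the two decisions does not
    increase it. *)
Lemma sampling_potential (T I : eqType) (U : seq T) (J : seq I)
    (w : I -> T -> R) (p beta : R) (alpha : I -> R) :
  0 <= p <= 1 -> 0 <= beta -> (forall i u, 0 <= w i u <= 1) ->
  (forall i, 0 <= alpha i) ->
  exists2 V, subseq V U &
    beta * (size V)%:R + \sum_(i <- J) alpha i *
      expR (p * (\sum_(u <- U) w i u) / 2 - \sum_(u <- V) w i u)
    <= beta * p * (size U)%:R + \sum_(i <- J) alpha i.
Proof.
move=> p01 beta0 w01; elim: U alpha => [|u U IH] alpha alpha0.
  exists [::] => //=; rewrite mulr0 mulr0 !add0r.
  by apply: ler_sum => i _; rewrite !big_nil !(mulr0, mul0r) subr0 expR0 mulr1.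
pose ain i := alpha i * expR (p * w i u / 2 - w i u).
pose aout i := alpha i * expR (p * w i u / 2).
have [Vin sin Hin] := IH ain (fun i => mulr_ge0 (alpha0 i) (expR_ge0 _)).
have [Vout sout Hout] := IH aout (fun i => mulr_ge0 (alpha0 i) (expR_ge0 _)).
set Xin := \sum_(i <- J) ain i in Hin; set Xout := \sum_(i <- J) aout i in Hout.
have avg : p * Xin + (1 - p) * Xout <= \sum_(i <- J) alpha i.
  rewrite !big_distrr -big_split/=; apply: ler_sum => i _.
  rewrite /ain /aout mulrCA [X in _ + X]mulrCA -mulrDr ler_piMr//.
  exact: sampling_average.
case/andP: p01 => p0 p1.
have [good|bad] := leP (beta + Xin) (beta * p + \sum_(i <- J) alpha i).
  exists (u :: Vin); first by rewrite /= eqxx.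
  under eq_bigr => i _.
    rewrite !big_cons (_ : alpha i * _ = ain i *
      expR (p * (\sum_(u <- U) w i u) / 2 - \sum_(u <- Vin) w i u)); last first.
      by rewrite /ain -[RHS]mulrA -expRD; congr (_ * expR _); ring.
    over.
  rewrite /= -[(size U).+1%:R]natr1 -[(size Vin).+1%:R]natr1 !mulrDr !mulr1.
  by move: Hin good; set Y := \sum_(i <- J) _ * _; lra.
exists Vout; first exact: subseq_trans sout (subseq_cons _ _).
under eq_bigr => i _.
  rewrite big_cons (_ : alpha i * _ = aout i *
    expR (p * (\sum_(u <- U) w i u) / 2 - \sum_(u <- Vout) w i u)); last first.
    by rewrite /aout -[RHS]mulrA -expRD; congr (_ * expR _); ring.
  over.
rewrite /= -[(size U).+1%:R]natr1 mulrDr mulr1; move: Hout bad avg; set Y := \sum_(i <- J) _ * _.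
set S := \sum_(i <- J) alpha i => Hout bad avg.
have pn1 : p < 1.
  rewrite lt_neqAle p1 andbT; apply/eqP => pE.
  by move: bad avg; rewrite pE; lra.
suff : Xout <= beta * p + S by lra.
rewrite -(ler_pM2l (x := 1 - p)) ?subr_gt0//.
have : p * (S - beta * (1 - p)) <= p * Xin by rewrite ler_wpM2l//; lra.
by move: avg; rewrite !(mulrBr, mulrBl, mulrDr); lra.
Qed.

(** A random subset of density [p] keeps about [p * M] of a weight [M]; a Chernoff
    bound makes it keep [p * M / 4] of all the weights of the family [J] at once,
    as long as the number of these weights is at most exponential in [p * M]. *)
Lemma sample_exists (T I : eqType) (U : seq T) (J : seq I)
    (w : I -> T -> R) (p M : R) :
  0 < p <= 1 -> (forall i u, 0 <= w i u <= 1) ->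
  (forall i, i \in J -> M <= \sum_(u <- U) w i u) ->
  (size J)%:R * expR (- (p * M / 4)) < 1 / 2 ->
  exists V, [/\ subseq V U, (size V)%:R <= 2 * p * (size U)%:R &
    forall i, i \in J -> p * M / 4 <= \sum_(u <- V) w i u].
Proof.
move=> /andP[p0 p1] w01 HM HJ; pose m := p * M / 4.
have [U0|U0] := posnP (size U).
  exists [::]; split => [||i iJ]; [exact: sub0seq|by rewrite U0 mulr0|].
  have := HM i iJ; rewrite (size0nil U0) !big_nil => M0.
  by rewrite pmulr_lle0// pmulr_rle0.
have u0 : (0 : R) < (size U)%:R by rewrite ltr0n.
pose be := (2 * p * (size U)%:R)^-1.
have be0 : 0 < be by rewrite invr_gt0 mulr_gt0 ?mulr_gt0.
(* the normalisations make the initial potential smaller than 1, and a set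
   violating one of the bounds would have potential at least 1 *)
have [||||V sV] := @sampling_potential T I U J w p be (fun=> expR (- m)).
- by rewrite ltW.
- exact: ltW.
- exact: w01.
- by move=> _; exact: expR_ge0.
rewrite big_const_seq count_predT iter_addr_0 -[expR _ *+ _]mulr_natl.
have -> : be * p * (size U)%:R = 1 / 2.
  rewrite /be; field; apply/andP; split; apply: lt0r_neq0; [exact: u0|exact: p0].
set X := \sum_(i <- J) _ => HV.
have lt1 : be * (size V)%:R + X < 1.
  by apply: (le_lt_trans HV); move: HJ; rewrite -/m; lra.
have X0 : 0 <= X by apply: sumr_ge0 => i _; rewrite mulr_ge0 ?expR_ge0.
have beV : 0 <= be * (size V)%:R by rewrite mulr_ge0 ?(ltW be0).
exists V; split => //.
  have : be * (size V)%:R <= 1 by lra.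
  by rewrite /be mulrC ler_pdivrMr ?mul1r// !mulr_gt0.
move=> i iJ; have Xi : expR (- m) *
    expR (p * (\sum_(u <- U) w i u) / 2 - \sum_(u <- V) w i u) <= X.
  rewrite /X (big_rem i)//= lerDl.
  by apply: sumr_ge0 => k _; rewrite mulr_ge0 ?expR_ge0.
have : expR (- m + (p * (\sum_(u <- U) w i u) / 2 - \sum_(u <- V) w i u)) < 1.
  by rewrite expRD; apply: (le_lt_trans Xi); lra.
rewrite expR_lt1 => Hlt.
have : p * M <= p * \sum_(u <- U) w i u by rewrite ler_wpM2l ?HM ?ltW.
by rewrite -/m; move: Hlt; rewrite /m; lra.
Qed.

End Sampling.

(** * A sparse tree of translations meeting every translate *)

Section SparseTree.
Context {R : realType} {n : nat}.
Variable b : nat.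
Hypothesis b_gt1 : (1 < b)%N.
Local Notation Zn := 'rV[int]_n.
Implicit Types (z a v : Zn) (V : seq Zn).

Let b_gt0 : (0 < b)%N. Proof. exact: ltnW. Qed.

Lemma digit_inj (x y : int) (d d' : nat) : (d < b)%N -> (d' < b)%N ->
  b%:Z * x + d%:Z = b%:Z * y + d'%:Z -> x = y.
Proof.
move=> h1 h2 E; have b0 := b_gt0.
by apply/eqP; rewrite eq_le !leNgt; apply/andP; split; apply/negP => xy; nia.
Qed.

Definition box j : set Zn := [set a | forall i, 0 <= a ord0 i < (b ^ j)%:Z].

Definition box_seq j : seq Zn :=
  [seq \row_i (d ord0 i)%:Z | d : 'rV['I_(b ^ j)]_n <- enum 'rV['I_(b ^ j)]_n].

Lemma size_box_seq j : size (box_seq j) = ((b ^ j) ^ n)%N.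
Proof. by rewrite size_map -cardE card_mx card_ord mul1n. Qed.

Lemma mem_box_seq j a : box j a -> a \in box_seq j.
Proof.
move=> aj; have H i : (absz (a ord0 i) < b ^ j)%N by have := aj i; lia.
apply/mapP; exists (\row_i Ordinal (H i)); first by rewrite mem_enum.
by apply/rowP => i; rewrite !mxE /= gez0_abs//; case/andP: (aj i).
Qed.

Lemma box_seqP j a : a \in box_seq j -> box j a.
Proof.
by move=> /mapP[d _ ->] i; rewrite !mxE /= ltz_nat ltn_ord.
Qed.

Definition parent a : Zn := \row_i (a ord0 i %/ b%:Z)%Z.

Lemma box_parent j a : box j.+1 a -> box j (parent a).
Proof.
move=> aj i; have /andP[h0 h1] := aj i; rewrite !mxE.
have b0 : 0 < b%:Z by rewrite ltz_nat.
by rewrite divz_ge0// h0/= ltz_divLR// -PoszM mulnC -expnS.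
Qed.

(** The offsets range over all of [-b, b) rather than over the [b] children of a
    point, so that the differences between a grid point and its parent can be
    absorbed: see [expand_sum]. *)
Definition expand V : seq Zn := undup [seq
  \row_i (b%:Z * v ord0 i + (d ord0 i)%:Z - b%:Z) |
    v : Zn <- V, d : 'rV['I_(2 * b)]_n <- enum 'rV['I_(2 * b)]_n].

Lemma size_expand V : (size (expand V) <= size V * (2 * b) ^ n)%N.
Proof.
apply: (leq_trans (size_undup _)).
by rewrite size_allpairs -cardE card_mx card_ord mul1n.
Qed.

Lemma mem_expand V v' : v' \in expand V ->
  exists2 v, v \in V & forall i, `|v' ord0 i - b%:Z * v ord0 i| <= b%:Z.
Proof.
rewrite mem_undup => /allpairsP[[v d] [vV _ ->]]; exists v => // i.
rewrite !mxE /= (_ : _ - _ = (d ord0 i)%:Z - b%:Z); last by ring.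
by have := ltn_ord (d ord0 i); lia.
Qed.

(** Here [w0] and [w1] are the masses of the cells of two successive levels, and a
    point [v] sees from [a] the mass of the cell [a - v]. The mass seen from the
    parent of [a'] is recovered from [a'] itself. *)
Lemma expand_sum V (w0 w1 : Zn -> R) a' : uniq V ->
  (forall z, 0 <= w1 z) ->
  (forall z, w0 z <= \sum_(d : 'rV['I_b]_n) w1 (child z d)) ->
  \sum_(v <- V) w0 (parent a' - v) <= \sum_(v' <- expand V) w1 (a' - v').
Proof.
move=> uV w10 w01.
pose g v (d : 'rV['I_b]_n) : Zn := a' - child (parent a' - v) d.
have gE v d i : g v d ord0 i =
    b%:Z * v ord0 i + (a' ord0 i %% b%:Z)%Z - (d ord0 i)%:Z.
  by rewrite !mxE {1}(divz_eq (a' ord0 i) b%:Z); ring.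
have ab i : 0 <= (a' ord0 i %% b%:Z)%Z < b%:Z.
  by rewrite modz_ge0 ?ltz_pmod// ?ltz_nat//; case: (b) b_gt0.
have -> : \sum_(v' <- expand V) w1 (a' - v') =
    fine (\sum_(v' <- expand V) (w1 (a' - v'))%:E)%E by rewrite sumEFin.
apply: (@le_trans _ _ (\sum_(v <- V) \sum_(d : 'rV['I_b]_n) w1 (a' - g v d))).
  apply: ler_sum => v _; apply: (le_trans (w01 _)); apply: ler_sum => d _.
  by rewrite /g subKr.
have guniq : uniq [seq g v d | v <- V, d <- enum 'rV['I_b]_n].
  apply: allpairs_uniq => //; first exact: enum_uniq.
  move=> [v d] [v' d'] _ _ /= /(congr1 (fun x => a' - x)); rewrite /g !subKr => H.
  have dE : parent a' - v = parent a' - v'.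
    apply/rowP => i; move/rowP: H => /(_ i); rewrite !mxE.
    exact: digit_inj (ltn_ord _) (ltn_ord _).
  congr (_, _); first by apply/oppr_inj/(addrI (parent a')).
  by move: H; rewrite dE; exact: child_inj.
have -> : \sum_(v <- V) \sum_(d : 'rV['I_b]_n) w1 (a' - g v d) =
    \sum_(v' <- [seq g v d | v <- V, d <- enum 'rV['I_b]_n]) w1 (a' - v').
  by rewrite big_allpairs_dep; apply: eq_bigr => v _; rewrite big_enum.
rewrite -lee_fin -sumEFin fineK; last by rewrite sumEFin.
apply: lee_sum_sub_seq => // [_ /allpairsP[[v d] [vV _ ->]]|v]; last first.
  by rewrite lee_fin.
rewrite mem_undup; apply/allpairsP.
have hd i : ((d : 'rV['I_b]_n) ord0 i < b)%N by exact: ltn_ord.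
have H i : (absz ((a' ord0 i %% b%:Z)%Z -
    ((d : 'rV['I_b]_n) ord0 i)%:Z + b%:Z)%R < 2 * b)%N.
  by have := ab i; have := hd i; lia.
exists (v, \row_i Ordinal (H i)); split; rewrite ?mem_enum//.
apply/rowP => i; rewrite gE !mxE /= gez0_abs; first by ring.
by have := ab i; have := hd i; lia.
Qed.

Section Thinning.
Variable beta : R.
Hypothesis beta_gt0 : 0 < beta.
Hypothesis beta_le8 : 8 * beta <= 1.
Variable w : nat -> Zn -> R.
Hypothesis w_ge0 : forall j z, 0 <= w j z.
Hypothesis w_le : forall j z, w j z <= beta ^+ j.
Hypothesis w_child : forall j z,
  w j z <= \sum_(d : 'rV['I_b]_n) w j.+1 (child z d).

(** Without thinning, no mass is ever lost. *)
Lemma full_tree_sum z0 j a : box j a ->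
  w 0 z0 <= \sum_(v <- iter j expand [:: - z0]) w j (a - v).
Proof.
elim: j a => [|j IH] a aj /=.
  rewrite big_seq1 (_ : a = 0) ?sub0r ?opprK//.
  apply/rowP => i; rewrite mxE; have /andP[] := aj i; rewrite expn0 => h0 h1.
  by apply/le_anti; rewrite h0 andbT -ltzD1 add0r.
apply: (le_trans (IH _ (box_parent aj))); apply: expand_sum => //.
by case: (j) => //= k; exact: undup_uniq.
Qed.

(** Keep a proportion [8 * beta] of the points: the mass seen from every point of
    the grid, measured in the unit [beta ^+ j] of its level, at least doubles. *)
Lemma thin_step j V s : uniq V ->
  (forall a, box j a -> s <= \sum_(v <- V) w j (a - v)) ->
  ((b ^ j.+1) ^ n)%:R * expR (- (2 * s / beta ^+ j)) < 1 / 2 ->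
  exists V', [/\ uniq V', {subset V' <= expand V},
    (size V')%:R <= (16 * beta * (2 * b)%:R ^+ n) * (size V)%:R &
    forall a, box j.+1 a -> 2 * beta * s <= \sum_(v <- V') w j.+1 (a - v)].
Proof.
move=> uV Vs small; pose rho := beta ^+ j.+1.
have rho0 : 0 < rho by rewrite exprn_gt0.
pose wt (a v : Zn) := w j.+1 (a - v) / rho.
have [||||V' [sV' szV' HV']] := @sample_exists R Zn Zn (expand V)
    (box_seq j.+1) wt (8 * beta) (s / rho).
- by rewrite beta_le8 andbT mulr_gt0.
- by move=> a v; rewrite divr_ge0 ?(ltW rho0)//= ler_pdivrMr// mul1r w_le.
- move=> a /box_seqP aj; rewrite -mulr_suml ler_pM2r ?invr_gt0//.
  by apply: (le_trans (Vs _ (box_parent aj))); exact: expand_sum.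
- rewrite size_box_seq (_ : 8 * beta * _ / 4 = 2 * s / beta ^+ j)//.
  rewrite /rho exprS; field; apply/andP; split; last exact: lt0r_neq0.
  by rewrite expf_neq0// lt0r_neq0.
exists V'; split.
- exact: subseq_uniq sV' (undup_uniq _).
- exact: mem_subseq.
- apply: (le_trans szV'); rewrite [2 * _]mulrA -natrM -mulrA.
  have -> : (2 * 8)%N = 16%N by [].
  apply: (@le_trans _ _ (16 * (beta * (size V * (2 * b) ^ n)%:R))).
    by rewrite !ler_wpM2l ?(ltW beta_gt0)// ler_nat size_expand.
  by rewrite natrM natrX le_eqVlt; apply/orP; left; apply/eqP; ring.
- move=> a aj; have := HV' a (mem_box_seq aj).
  rewrite -mulr_suml ler_pdivlMr//; apply: le_trans.
  rewrite (_ : _ / 4 * rho = 2 * beta * s)//; field; exact: lt0r_neq0.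
Qed.

(** At level [j0 + i] the mass available, in the unit of the level, is
    [2 ^ i * (c0 / beta ^ j0)]: it outgrows the logarithm of the number of grid
    points, provided that the doubling starts at a fine enough level [j0]. *)
Lemma thin_start (c0 : R) : 0 < c0 -> exists j0, forall i,
  ((b ^ (j0 + i).+1) ^ n)%:R *
    expR (- (2 * (c0 * (2 * beta) ^+ i) / beta ^+ (j0 + i))) < 1 / 2.
Proof.
move=> c00; pose B : R := (b * n)%:R + 1.
have B1 : 1 <= B by rewrite /B lerDr ler0n.
pose j0 := (Num.truncn (B / c0)).+1.
have j0B : B <= c0 * (2 ^ j0)%:R.
  rewrite -ler_pdivrMl// mulrC; apply: (@le_trans _ _ j0%:R).
    by apply/ltW/truncnS_gt.
  by rewrite ler_nat ltnW// ltn_expl.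
exists j0 => i; set X := 2 * _ / _.
have XE : X = (2 ^ i.+1)%:R * c0 / beta ^+ j0.
  rewrite /X exprD exprMn natrX exprS; field.
  by apply/andP; split; rewrite expf_neq0// lt0r_neq0.
have X1 : (b * n)%:R * (j0 + i).+1%:R + 1 <= X.
  have h8 : (8 ^ j0)%:R <= (beta ^+ j0)^-1.
    rewrite natrX -exprVn; apply: lerXn2r; rewrite ?nnegrE ?invr_ge0 ?(ltW beta_gt0)//.
    by rewrite -[leRHS]mul1r ler_pdivlMr.
  have hm : ((j0 + i).+1 <= i.+1 * j0.+1)%N by nia.
  apply: (@le_trans _ _ (B * (i.+1 * j0.+1)%:R)).
    rewrite /B mulrDl mul1r lerD//; last by rewrite ler1n muln_gt0.
    by rewrite ler_wpM2l ?ler_nat.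
  apply: (@le_trans _ _ (c0 * (2 ^ j0)%:R * (2 ^ i.+1 * 4 ^ j0)%:R)).
    apply: ler_pM => //; first exact: le_trans B1.
    rewrite ler_nat leq_mul//; last by rewrite ltn_expl.
    by rewrite ltnW// ltn_expl.
  rewrite XE; apply: (@le_trans _ _ ((2 ^ i.+1)%:R * c0 * (8 ^ j0)%:R)).
    rewrite -[8%N]/(2 * 4)%N expnMn !natrM le_eqVlt; apply/orP; left; apply/eqP.
    by ring.
  by rewrite ler_wpM2l// mulr_ge0// ltW.
have hb : ((b ^ (j0 + i).+1) ^ n)%:R <= expR ((b * n)%:R * (j0 + i).+1%:R) :> R.
  rewrite -expnM natrX (_ : (b * n)%:R * _ = ((j0 + i).+1 * n)%:R * b%:R); last first.
    by rewrite -!natrM; congr _%:R; lia.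
  rewrite expRM_natl; apply: lerXn2r; rewrite ?nnegrE ?expR_ge0//.
  by apply: le_trans (expR_ge1Dx _); rewrite lerDr.
apply: (@le_lt_trans _ _ (expR (-1))).
  apply: (@le_trans _ _ (expR ((b * n)%:R * (j0 + i).+1%:R) * expR (- X))).
    by rewrite ler_wpM2r ?expR_ge0.
  by rewrite -expRD ler_expR; lra.
rewrite expRN mul1r ltf_pV2 ?posrE ?expR_gt0//.
by have := @expR_gt1Dx R 1 (oner_neq0 _).
Qed.

(** The tree is full down to level [j0] and thinned below: its levels then grow by
    at most the factor [16 * beta * (2 * b) ^ n], while mass remains visible from
    every point of the grid. *)
Theorem sparse_tree z0 : 0 < w 0 z0 ->
  exists (j0 : nat) (V : nat -> seq Zn) (N0 : R), [/\ 0 <= N0,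
    forall i, {subset V i.+1 <= expand (V i)},
    forall i, (size (V i))%:R <= N0 * (16 * beta * (2 * b)%:R ^+ n) ^+ i &
    forall i a, box (j0 + i) a -> 0 < \sum_(v <- V i) w (j0 + i) (a - v)].
Proof.
move=> c0; have [j0 Hj0] := thin_start c0.
pose V0 := iter j0 expand [:: - z0]; pose N0 : R := (size V0)%:R.
pose L : R := 16 * beta * (2 * b)%:R ^+ n.
pose P i V := [/\ uniq V, (size V)%:R <= N0 * L ^+ i & forall a, box (j0 + i) a ->
   w 0 z0 * (2 * beta) ^+ i <= \sum_(v <- V) w (j0 + i) (a - v)].
have L0 : 0 <= L by rewrite !mulr_ge0 ?exprn_ge0// ltW.
have P0 : P 0%N V0.
  split; first by rewrite /V0; case: (j0) => //= k; exact: undup_uniq.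
    by rewrite expr0 mulr1.
  by move=> a; rewrite addn0 expr0 mulr1; exact: full_tree_sum.
have step (iV : nat * seq Zn) : exists V', P iV.1 iV.2 ->
    P iV.1.+1 V' /\ {subset V' <= expand iV.2}.
  case: iV => i V /=; have [[uV sV HV]|nP] := pselect (P i V); last by exists [::].
  have [V' [uV' sub sV' HV']] := thin_step uV HV (Hj0 i).
  exists V' => _; split => //; split => //.
    by apply: (le_trans sV'); rewrite exprSr mulrA [leRHS]mulrC ler_wpM2l.
  move=> a; rewrite addnS => /HV'; apply: le_trans.
  by rewrite exprSr mulrA mulrC.
have [f Hf] := boolp.choice step.
pose V := fix V i := if i is k.+1 then f (k, V k) else V0.
have PV i : P i (V i) by elim: i => [//|i IH]; exact: (Hf (i, V i) IH).1.
exists j0, V, N0; split => //.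
- by move=> i; exact: (Hf (i, V i) (PV i)).2.
- by move=> i; have [] := PV i.
- move=> i a ia; have [_ _ H] := PV i.
  apply: lt_le_trans (H a ia).
  by rewrite mulr_gt0// exprn_gt0// mulr_gt0.
Qed.

End Thinning.
End SparseTree.

(** * The compact set carried by a tree *)

Section EuclideanNorm.
Context {R : realType} {n : nat}.
Implicit Types (x y : 'rV[R]_n) (B : set 'rV[R]_n).

Lemma enorm_ge0 x : 0 <= enorm x. Proof. exact: sqrtr_ge0. Qed.

Lemma enormB x y : enorm (x - y) = enorm (y - x).
Proof.
by congr Num.sqrt; apply: eq_bigr => i _; rewrite !mxE -[in RHS]opprB sqrrN.
Qed.

Lemma enorm_le x r : 0 <= r -> (forall i, `|x ord0 i| <= r) ->
  enorm x <= n%:R * r.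
Proof.
move=> r0 xr; have nr0 : 0 <= n%:R * r by rewrite mulr_ge0.
rewrite -(ger0_norm nr0) -sqrtr_sqr; apply: ler_wsqrtr.
apply: (@le_trans _ _ (\sum_(i < n) r ^+ 2)).
  apply: ler_sum => i _; rewrite -[x ord0 i ^+ 2]real_normK ?num_real//.
  by rewrite lerXn2r ?nnegrE.
rewrite sumr_const card_ord -[_ *+ _]mulr_natl exprMn ler_wpM2r ?sqr_ge0//.
by rewrite -natrX ler_nat; case: (n) => // k; rewrite leq_pmulr.
Qed.

Lemma coord_le_enorm x i : `|x ord0 i| <= enorm x.
Proof.
rewrite -sqrtr_sqr; apply: ler_wsqrtr.
by rewrite (bigD1 i)//= lerDl sumr_ge0// => k _; exact: sqr_ge0.
Qed.

Lemma norm_le_enorm x : `|x| <= enorm x.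
Proof. by apply: norm_le_coord; [exact: enorm_ge0|exact: coord_le_enorm]. Qed.

(** The form of the bound [upper_minkowski_dim B <= tau] in which a constant is
    allowed: trees provide it, and it controls packings. *)
Definition covering_bound (tau : R) B := exists (C delta : R),
  [/\ 0 <= C, 0 < delta & forall r, 0 < r < delta -> exists s : seq 'rV[R]_n,
    B `<=` \bigcup_(c in [set` s]) eball c r /\
    (size s)%:R <= C * r `^ (- tau)].

End EuclideanNorm.

Section TreeSet.
Context {R : realType} {n : nat}.
Variable b : nat.
Hypothesis b_gt1 : (1 < b)%N.
Variables (j0 : nat) (V : nat -> seq 'rV[int]_n).
Hypothesis V_expand : forall i, {subset V i.+1 <= expand b (V i)}.

Let b0 : (0 : R) < b%:R. Proof. by rewrite ltr0n ltnW. Qed.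

Definition mesh i : R := (b%:R ^+ (j0 + i))^-1.

Lemma mesh_gt0 i : 0 < mesh i.
Proof. by rewrite invr_gt0 exprn_gt0. Qed.

Lemma meshS i : b%:R * mesh i.+1 = mesh i.
Proof. by rewrite /mesh addnS exprS invfM mulrA mulfV ?mul1r// gt_eqF. Qed.

Lemma meshS_half i : 2 * mesh i.+1 <= mesh i.
Proof. by rewrite -(meshS i) ler_pM2r ?mesh_gt0// ler_nat. Qed.

Lemma mesh_small e : 0 < e -> exists i, mesh i < e.
Proof.
move=> e0; exists (Num.truncn e^-1).+1.
rewrite /mesh invf_plt ?posrE ?exprn_gt0//.
apply: (lt_le_trans (truncnS_gt _)); rewrite -natrX ler_nat.
apply: (@leq_trans (j0 + (Num.truncn e^-1).+1)); first exact: leq_addl.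
by rewrite ltnW// ltn_expl.
Qed.

(** The radius [3 * mesh i] makes room for the whole subtree below a point. *)
Definition level_set i : set 'rV[R]_n := \bigcup_(v in [set` V i])
  [set x : 'rV[R]_n | forall l, `|x ord0 l - (v ord0 l)%:~R * mesh i| <= 3 * mesh i].

Definition tree_set : set 'rV[R]_n := \bigcap_i level_set i.

Lemma compact_level_set i : compact (level_set i).
Proof.
rewrite /level_set -bigsetU_fset_set; last exact: finite_seq.
apply: bigsetU_compact => v _.
set m := mesh i.
rewrite (_ : [set x : 'rV[R]_n | _] = [set x : 'rV[R]_n | forall l,
    `[(v ord0 l)%:~R * m - 3 * m, (v ord0 l)%:~R * m + 3 * m]%classic
      (x ord0 l)]); last first.
  apply/seteqP; split => x H l; have := H l; rewrite /= in_itv/= ler_distl//.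
have := @rV_compact R _ (fun l => `[(v ord0 l)%:~R * m - 3 * m,
  (v ord0 l)%:~R * m + 3 * m]%classic).
by apply => l; exact: segment_compact.
Qed.

Lemma closed_level_set i : closed (level_set i).
Proof.
have := @compact_closed 'rV[R]_n (level_set i) (@norm_hausdorff R 'rV[R]_n).
by apply; exact: compact_level_set.
Qed.

Lemma compact_tree_set : compact tree_set.
Proof.
have := @subclosed_compact 'rV[R]_n tree_set (level_set 0).
apply; [|exact: compact_level_set|by move=> x /(_ 0%N I)].
by apply: closed_bigI => i _; exact: closed_level_set.
Qed.

(** The points of the tree below [v'] stay within [2 * mesh m] of it, by summation
    of a geometric series. *)
Lemma tree_drift m k v : v \in V (m + k) -> exists2 v', v' \in V m &
  forall l, `|(v ord0 l)%:~R * mesh (m + k) - (v' ord0 l)%:~R * mesh m| <=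
     2 * (mesh m - mesh (m + k)).
Proof.
elim: k v => [|k IH] v.
  by rewrite addn0 => vV; exists v => // l; rewrite !subrr normr0 mulr0.
rewrite addnS => /V_expand/(mem_expand b_gt1)[u /IH[v' v'V Hv'] uv].
exists v' => // l; have h1 := Hv' l; have h2 := meshS_half (m + k).
have h3 : `|(v ord0 l)%:~R * mesh (m + k).+1 - (u ord0 l)%:~R * mesh (m + k)|
    <= mesh (m + k).
  rewrite -(meshS (m + k)) mulrA -mulrBl normrM (gtr0_norm (mesh_gt0 _)).
  rewrite ler_pM2r ?mesh_gt0//.
  have := uv l; rewrite -(ler_int R) intr_norm rmorphB rmorphM/=.
  by rewrite [_ * b%:R]mulrC.
apply: (le_trans (ler_distD ((u ord0 l)%:~R * mesh (m + k)) _ _)).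
by apply: (le_trans (lerD h3 h1)); lra.
Qed.

Lemma level_set_near m k v (x : 'rV[R]_n) : v \in V (m + k) ->
  (forall l, `|x ord0 l - (v ord0 l)%:~R * mesh (m + k)| <= mesh (m + k)) ->
  level_set m x.
Proof.
move=> /tree_drift[v' v'V Hv'] xv; exists v' => // l.
apply: (le_trans (ler_distD ((v ord0 l)%:~R * mesh (m + k)) _ _)).
apply: (le_trans (lerD (xv l) (Hv' l))).
by have := mesh_gt0 (m + k); have := mesh_gt0 m; lra.
Qed.

Variable K : set 'rV[R]_n.
Hypothesis Kco : compact K.
Hypothesis V_hits : forall i a, box b (j0 + i) a ->
  exists2 v, v \in V i & exists2 y, K y & key b (j0 + i) y = a - v.

(** At every level [i] some [y i] in [K] has [x - y i] in the level sets of index at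
    most [i]; a cluster point of these [y i] does for all levels. *)
Lemma tree_set_hits : [set x : 'rV[R]_n | forall l, 0 <= x ord0 l < 1] `<=`
  minkowski_sum K tree_set.
Proof.
move=> x x01.
have Hbox i : box b (j0 + i) (key b (j0 + i) x).
  move=> l; rewrite !mxE; case/andP: (x01 l) => h0 h1.
  have bj : (0 : R) < b%:R ^+ (j0 + i) by rewrite exprn_gt0.
  rewrite floor_ge0 mulr_ge0 ?(ltW bj)//= floor_lt_int.
  by rewrite -[X in _ < X]/((b ^ (j0 + i))%:R) natrX -[ltRHS]mulr1 ltr_pM2l.
have H i : exists yv : 'rV[R]_n * 'rV[int]_n, [/\ K yv.1, yv.2 \in V i &
    key b (j0 + i) yv.1 = key b (j0 + i) x - yv.2].
  by have [v vV [y Ky yE]] := V_hits (Hbox i); exists (y, v).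
have [f Hf] := boolp.choice H.
pose y i := (f i).1.
have Hy m i : (m <= i)%N -> level_set m (x - y i).
  move=> /subnKC <-; set k := (i - m)%N.
  have [_ vV /rowP yE] := Hf (m + k)%N.
  apply: level_set_near vV _ => l; have := yE l; rewrite !mxE => {}yE.
  have bj : (0 : R) < b%:R ^+ (j0 + (m + k)) by rewrite exprn_gt0.
  have := floor_itv (b%:R ^+ (j0 + (m + k)) * x ord0 l).
  have := floor_itv (b%:R ^+ (j0 + (m + k)) * y (m + k)%N ord0 l).
  rewrite {}[Num.floor (_ * y _ _ _)]yE -/(y _).
  set v := (f (m + k)%N).2 ord0 l; set a := Num.floor _.
  rewrite !rmorphD/= !rmorphN/= !rmorph1 => /andP[h1 h2] /andP[h3 h4].
  rewrite -(ler_pM2l bj) {2}/mesh mulfV ?gt_eqF//.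
  rewrite -{1}(gtr0_norm bj) -normrM mulrBr mulrCA /mesh mulfV ?gt_eqF// mulr1.
  by rewrite mulrBr ler_norml; apply/andP; split; lra.
have [|y0 [Ky0 cly]] := Kco (F := y @ \oo) _.
  by exists 0%N => // i _; have [] := Hf i.
exists y0 => //; exists (x - y0); last by rewrite addrC subrK.
move=> m _.
apply: closed_level_set => U /nbhs_ballP[e /= e0 eU].
have ym : (y @ \oo) [set u | level_set m (x - u)].
  by exists m => // i /= mi; exact: Hy.
have [u [/= mu y0u]] := cly _ _ ym (nbhsx_ballx y0 e e0).
by exists (x - u); split => //; apply: eU; exact: ball_subl.
Qed.

Variables (tau N0 : R).
Hypothesis N0_ge0 : 0 <= N0.
Hypothesis V_size : forall i, (size (V i))%:R <= N0 * (b%:R `^ tau) ^+ i.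

(** The levels of the tree are not empty, so their sizes cannot decay. *)
Lemma tree_exponent_ge0 : 0 <= tau.
Proof.
rewrite leNgt; apply/negP => tau0.
have bt1 : b%:R `^ tau < 1 :> R.
  by rewrite /powR gt_eqF// expR_lt1 nmulr_rlt0// ln_gt0// ltr1n.
have : (N0 * (b%:R `^ tau) ^+ i @[i --> \oo] --> (N0 * 0 : R)).
  apply: cvgM; first exact: cvg_cst.
  by apply: cvg_expr; rewrite ger0_norm ?powR_ge0.
rewrite mulr0 => /cvgrPdist_lt/(_ 1 ltr01)[i _ /(_ i (leqnn i))] /=.
rewrite sub0r normrN ger0_norm ?mulr_ge0 ?exprn_ge0 ?powR_ge0// => lt1.
have box0 : box b (j0 + i) (0 : 'rV[int]_n).
  by move=> l; rewrite mxE lexx/= ltz_nat expn_gt0 ltnW.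
have [v vV _] := V_hits box0.
have : (1 : R) <= (size (V i))%:R by rewrite ler1n; case: (V i) vV.
by apply/negP; rewrite -ltNge; exact: le_lt_trans lt1.
Qed.

(** At scale [r], use the first level whose mesh is of order [r]. *)
Lemma tree_set_covering : covering_bound tau tree_set.
Proof.
have tau0 := tree_exponent_ge0.
pose k : R := 3 * n.+1%:R.
have k0 : 0 < k by rewrite mulr_gt0.
exists (N0 * (k * b%:R) `^ tau), (k * mesh 0); split.
- by rewrite mulr_ge0 ?powR_ge0.
- by rewrite mulr_gt0 ?mesh_gt0.
move=> r /andP[r0 rk].
have ex : exists i, k * mesh i <= r.
  have [|i Hi] := @mesh_small (r / k); first by rewrite divr_gt0.
  by exists i; rewrite mulrC -ler_pdivlMr// ltW.
case: (ex_minnP ex) => -[|i] kr imin.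
  by move: rk; rewrite ltNge kr.
have rk' : r < k * mesh i.
  by rewrite ltNge; apply/negP => /imin; rewrite ltnn.
exists [seq \row_l ((v ord0 l)%:~R * mesh i.+1) | v : 'rV[int]_n <- V i.+1].
split.
  move=> x /(_ i.+1 I)[v vV xv].
  exists (\row_l ((v ord0 l)%:~R * mesh i.+1)).
    by rewrite /=; apply/mapP; exists v.
  rewrite /eball/=; apply: le_trans kr.
  apply: (@le_trans _ _ (n%:R * (3 * mesh i.+1))).
    apply: enorm_le => [|l]; first by rewrite mulr_ge0// ltW ?mesh_gt0.
    by rewrite !mxE.
  by rewrite /k mulrA [3 * _]mulrC ler_pM2r ?mesh_gt0// ler_pM2r// ler_nat.
rewrite size_map; apply: (le_trans (V_size _)); rewrite -mulrA ler_wpM2l//.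
rewrite -powR_mulrn ?powR_ge0// powRAC powR_mulrn ?(ltW b0)//.
rewrite powRN -powR_inv1 ?powR_ge0// powRAC powR_inv1 ?(ltW r0)//.
rewrite -powRM ?mulr_ge0 ?invr_ge0 ?(ltW k0) ?(ltW b0) ?(ltW r0)//.
apply: ge0_ler_powR => //.
- by rewrite nnegrE exprn_ge0// ltW.
- by rewrite nnegrE !mulr_ge0 ?invr_ge0 ?(ltW k0) ?(ltW b0) ?(ltW r0).
rewrite ler_pdivlMr//; apply: (@le_trans _ _ ((mesh i.+1)^-1 * r)).
  rewrite ler_pM2r// invrK addnC exprD ler_peMr ?exprn_ge0 ?(ltW b0)//.
  by rewrite exprn_ege1// ler1n ltnW.
by rewrite mulrC ler_pdivrMr ?mesh_gt0// -mulrA meshS ltW.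
Qed.

End TreeSet.

(** * Covering numbers, packings and dimensions *)

Section EsumReal.
Context {R : realType}.

Lemma esum_const_ord k (x : R) : 0 <= x ->
  (\esum_(i in `I_k) x%:E)%E = (k%:R * x)%:E.
Proof.
move=> x0; rewrite esum_fset//.
rewrite -(@fsbig_ord _ _ _ k (fun=> x%:E)).
by rewrite sumEFin sumr_const card_ord mulr_natl.
Qed.

Lemma esum_geometric_tail (q : R) k0 : 0 < q < 1 ->
  (\esum_(k in [set k | (k0 <= k)%N]) (q ^+ k)%:E <= (q ^+ k0 / (1 - q))%:E)%E.
Proof.
move=> /andP[q0 q1]; apply: ge_ereal_sup => _ [F [finF Fk0] <-].
have Hm m : (\sum_(k0 <= k < k0 + m) (q ^+ k) <= q ^+ k0 / (1 - q)).
  rewrite ler_pdivlMr ?subr_gt0//.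
  have -> : (\sum_(k0 <= k < k0 + m) q ^+ k) * (1 - q) = q ^+ k0 - q ^+ (k0 + m).
    elim: m => [|m IH]; first by rewrite addn0 big_geq// mul0r subrr.
    rewrite addnS big_nat_recr ?leq_addr//= mulrDl IH exprS; ring.
  by rewrite gerBl exprn_ge0// ltW.
pose m := (\max_(k <- enum_fset (fset_set F)) k).+1.
rewrite fsbig_finite//=; apply: le_trans (_ : ((\sum_(k0 <= k < k0 + m)
  q ^+ k)%:E <= _)%E); last by rewrite lee_fin.
rewrite -sumEFin; apply: lee_sum_sub_seq.
- exact: fset_uniq.
- move=> k kF; rewrite mem_index_iota; apply/andP; split.
    by apply: Fk0; move: kF; rewrite in_fset_set// inE.
  rewrite ltn_addl// ltnS; exact: (@leq_bigmax_seq _ _ xpredT id).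
- by move=> k; rewrite lee_fin exprn_ge0// ltW.
Qed.

End EsumReal.

Section Dimensions.
Context {R : realType} {n : nat}.
Implicit Types (B E : set 'rV[R]_n) (tau u r : R).

Lemma covering_number_le B r (s : seq 'rV[R]_n) :
  B `<=` \bigcup_(c in [set` s]) eball c r ->
  (covering_number r B <= (size s)%:R%:E)%E.
Proof.
move=> Bs; apply: ereal_inf_lbound; exists (size s) => //.
exists (fun i => nth 0 s i) => x /Bs[c /= cs xc].
have ic : (index c s < size s)%N by rewrite index_mem.
by exists (Ordinal ic) => //=; rewrite nth_index.
Qed.

Lemma upper_minkowski_dim_le tau tau' B : covering_bound tau B -> tau < tau' ->
  (upper_minkowski_dim B <= tau'%:E)%E.
Proof.
move=> [C [delta [C0 delta0 HB]]] tt'.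
pose e : R := expR (- (ln (C + 1) / (tau' - tau))).
have e0 : 0 < e by exact: expR_gt0.
pose d := Num.min delta (Num.min (1 / 2) e).
have d0 : 0 < d by rewrite !lt_min delta0 e0 andbT/=.
apply: (@le_trans _ _ (ereal_sup ((fun r => lne (covering_number r B) *
    ((ln r^-1)^-1)%:E)%E @` [set r | 0 < r < d]))).
  apply: ereal_inf_lbound; exists [set r | 0 < r < d] => //.
  exists d => // r /=; rewrite sub0r normrN => rd r0.
  by rewrite r0 -(gtr0_norm r0).
apply: ge_ereal_sup => _ [r /= /andP[r0 rd] <-].
move: rd; rewrite !lt_min => /and3P[rdelta r2 re].
have L0 : 0 < ln r^-1 by rewrite ln_gt0// invf_gt1//; lra.
have [s [Bs sz]] := HB r (introT andP (conj r0 rdelta)).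
have C1 : 0 < C + 1 by rewrite ltr_wpDl.
have lneN : (lne (covering_number r B) <= (ln (C + 1) + tau * ln r^-1)%:E)%E.
  have pos : 0 < (C + 1) * r `^ (- tau) by rewrite mulr_gt0 ?powR_gt0.
  have -> : ln (C + 1) + tau * ln r^-1 = ln ((C + 1) * r `^ (- tau)).
    by rewrite lnM ?posrE ?powR_gt0// ln_powR lnV ?posrE// mulrN mulNr.
  rewrite -lne_EFin// lee_lne.
  - apply: (le_trans (covering_number_le Bs)); rewrite lee_fin.
    by apply: (le_trans sz); rewrite ler_pM2r ?powR_gt0// lerDl.
  - rewrite in_itv/= leey andbT; apply: le_ereal_inf_tmp => _ [k _ <-].
    by rewrite lee_fin.
  - by rewrite in_itv/= leey andbT lee_fin ltW.
apply: (@le_trans _ _ ((ln (C + 1) + tau * ln r^-1)%:E * ((ln r^-1)^-1)%:E)%E).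
  by apply: lee_wpmul2r => //; rewrite lee_fin invr_ge0 ltW.
rewrite -EFinM lee_fin ler_pdivrMr// -lerBrDr -mulrBl mulrC.
rewrite -ler_pdivrMr ?subr_gt0// lnV ?posrE// lerNr.
by rewrite -[leRHS]expRK ler_ln ?posrE ?expR_gt0// ltW.
Qed.

Lemma upper_minkowski_dim_lt tau B : (upper_minkowski_dim B < tau%:E)%E ->
  covering_bound tau B.
Proof.
move=> /ereal_inf_lt[_ [W [d /= d0 dW] <-] Wtau].
exists 1, (Num.min d 1); split => //; first by rewrite lt_min d0 ltr01.
move=> r /andP[r0]; rewrite lt_min => /andP[rd r1].
have L0 : 0 < ln r^-1 by rewrite ln_gt0// invf_gt1.
have : (lne (covering_number r B) * ((ln r^-1)^-1)%:E < tau%:E)%E.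
  apply: le_lt_trans Wtau; apply: ereal_sup_ubound; exists r => //.
  by apply: dW => //=; rewrite sub0r normrN gtr0_norm.
rewrite lte_pdivrMr// -EFinM => Nlt.
have : (covering_number r B < (r `^ (- tau))%:E)%E.
  rewrite ltNge; apply/negP => Nge.
  move: Nlt; apply/negP; rewrite -leNgt.
  have -> : tau * ln r^-1 = ln (r `^ (- tau)).
    by rewrite ln_powR lnV ?posrE// mulrN mulNr.
  rewrite -lne_EFin ?powR_gt0// lee_lne// in_itv/= leey andbT.
    by rewrite lee_fin powR_ge0.
  apply: le_ereal_inf_tmp => _ [k _ <-].
  by rewrite lee_fin.
move=> /ereal_inf_lt[_ [k [c Bc] <-]]; rewrite lte_fin => kr.
exists [seq c i | i <- enum 'I_k]; rewrite size_map size_enum_ord mul1r.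
split; last exact: ltW.
move=> x /Bc[i _ xi]; exists (c i) => //=; apply/mapP; exists i => //.
by rewrite mem_enum.
Qed.

Lemma covering_bound_translate tau B z : covering_bound tau B ->
  covering_bound tau [set x + z | x in B].
Proof.
move=> [C [d [C0 d0 HB]]]; exists C, d; split => // r rd.
have [s [Bs sz]] := HB r rd.
exists [seq c + z | c <- s]; rewrite size_map; split => // _ [x /Bs[c /= cs xc] <-].
exists (c + z); first by apply/mapP; exists c.
by rewrite /eball/= opprD addrACA subrr addr0.
Qed.

Lemma packing_content_ge0 u d B : (0 <= packing_content u d B)%E.
Proof.
apply: ereal_sup_ubound; exists set0, (fun=> 0), (fun=> 0); split => //.
by rewrite esum_set0.
Qed.

Lemma packing_premeasure_ge0 u B : (0 <= packing_premeasure u B)%E.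
Proof.
by apply: le_ereal_inf_tmp => _ [d _ <-]; exact: packing_content_ge0.
Qed.

(** In a packing, the balls with radii between [2 ^- k.+1] and [2 ^- k] have their
    centres in distinct balls of a covering by balls of radius [2 ^- k.+1], for
    two of these centres would otherwise have balls meeting at the centre of the
    covering ball. *)
Lemma packing_premeasure0 tau u B : covering_bound tau B -> tau < u ->
  0 <= u -> packing_premeasure u B = 0%E.
Proof.
move=> [C [delta [C0 delta0 HB]]] tu u0.
pose q : R := 2 `^ (tau - u).
have q01 : 0 < q < 1.
  rewrite powR_gt0//= /q /powR gt_eqF// expR_lt1 nmulr_rlt0 ?subr_lt0//.
  by rewrite ln_gt0// ltr1n.
case/andP: (q01) => q0 q1.
apply/le_anti/andP; split; last exact: packing_premeasure_ge0.
apply/lee_addgt0Pr => e e0; rewrite add0e.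
(* the balls of scale [k] contribute at most [C * 2 `^ (tau + u) * q ^+ k] *)
pose M : R := C * 2 `^ (tau + u) / (1 - q).
have M0 : 0 <= M by rewrite divr_ge0 ?mulr_ge0 ?powR_ge0// subr_ge0 ltW.
have [k0 [k0M k0d]] : exists k0, q ^+ k0 * M <= e /\ (2 ^- k0 : R) < delta.
  have cq : (q ^+ m * M @[m --> \oo] --> (0 * M : R)).
    apply: cvgM; last exact: cvg_cst.
    by apply: cvg_expr; rewrite ger0_norm ?ltW.
  have c2 : ((2^-1 : R) ^+ m @[m --> \oo] --> (0 : R)).
    by apply: cvg_expr; rewrite ger0_norm ?invf_lt1 ?invr_ge0// ltr1n.
  move: cq; rewrite mul0r => /cvgrPdist_lt/(_ e e0)[m1 _ h1].
  move: c2 => /cvgrPdist_lt/(_ delta delta0)[m2 _ h2].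
  exists (maxn m1 m2); split.
    have := h1 _ (leq_maxl m1 m2).
    have qM : 0 <= q ^+ maxn m1 m2 * M.
      by apply: mulr_ge0 => //; rewrite exprn_ge0// ltW.
    by rewrite /= sub0r normrN ger0_norm// => /ltW.
  have := h2 _ (leq_maxr m1 m2).
  by rewrite /= sub0r normrN ger0_norm ?exprn_ge0 ?invr_ge0// exprVn.
apply: (@le_trans _ _ (packing_content u (2 * 2 ^- k0) B)).
  by apply: ereal_inf_lbound; exists (2 * 2 ^- k0) => //=; rewrite mulr_gt0 ?invr_gt0 ?exprn_gt0.
apply: ge_ereal_sup => _ [D [c [r [Dc Dr Dtriv ->]]]].
have half0 k : 0 < (2 ^- k : R) by rewrite invr_gt0 exprn_gt0.
have halfS k : (2 ^- k : R) = 2 * 2 ^- k.+1.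
  by rewrite exprS invfM mulrA mulfV ?mul1r.
have half_le k l : (k <= l)%N -> (2 ^- l : R) <= 2 ^- k.
  by move=> kl; rewrite -!exprVn ler_wiXn2l// ?invr_ge0 ?invf_le1 ?ler1n.
(* [lev i] is the dyadic scale of the radius of the ball of index [i] *)
have [lev Hlev] : exists lev : nat -> nat, forall i, D i ->
    [/\ (k0 <= lev i)%N, 2 ^- (lev i).+1 < r i & r i <= 2 ^- lev i].
  have H i : exists k, D i -> [/\ (k0 <= k)%N, 2 ^- k.+1 < r i & r i <= 2 ^- k].
    have [Di|nDi] := pselect (D i); last by exists 0%N.
    have [r0 rk0] := Dr i Di.
    have ex : exists k, (2 ^- k.+1 : R) < r i.
      have c2 : ((2^-1 : R) ^+ m @[m --> \oo] --> (0 : R)).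
        by apply: cvg_expr; rewrite ger0_norm ?invf_lt1 ?invr_ge0// ltr1n.
      move: c2 => /cvgrPdist_lt/(_ (r i) r0)[m _ hm]; exists m.
      have := hm m.+1 (leqnSn m).
      by rewrite /= sub0r normrN ger0_norm ?exprn_ge0 ?invr_ge0// exprVn.
    case: (ex_minnP ex) => k kr kmin; exists k => _.
    have rle : r i <= 2 ^- k0 by rewrite -(ler_pM2l (ltr0n R 2)).
    split => //.
      rewrite -ltnS ltnNge; apply/negP => /half_le h.
      by move: kr; rewrite ltNge (le_trans rle h).
    case: k kr kmin => [|k] kr kmin.
      by apply: (le_trans rle); exact: half_le.
    by rewrite leNgt; apply/negP => /kmin; rewrite ltnn.
  by have [lev Hlev] := boolp.choice H; exists lev.
have cov k : exists s : seq 'rV[R]_n, (k0 <= k)%N ->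
    B `<=` \bigcup_(x in [set` s]) eball x (2 ^- k.+1) /\
    (size s)%:R <= C * (2 ^- k.+1) `^ (- tau).
  have [kk0|nk] := boolP (k0 <= k)%N; last by exists [::].
  have [|s Hs] := HB (2 ^- k.+1); last by exists s.
  by rewrite half0/=; apply: le_lt_trans k0d; apply: half_le; exact: leqW.
have [S HS] := boolp.choice cov.
have ind i : exists l, D i -> (l < size (S (lev i)))%N /\
    enorm (c i - nth 0 (S (lev i)) l) <= 2 ^- (lev i).+1.
  have [Di|nDi] := pselect (D i); last by exists 0%N.
  have [k0l _ _] := Hlev i Di; have [+ _] := HS (lev i) k0l.
  move=> /(_ _ (Dc i Di))[x /= xS xc]; exists (index x (S (lev i))) => _.
  by rewrite index_mem nth_index.
(* [l i] is the rank of a covering ball containing the centre [c i] *)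
have [l Hl] := boolp.choice ind.
pose g k : R := (2 * 2 ^- k) `^ u.
have g0 k : 0 <= g k by exact: powR_ge0.
pose f i := (lev i, l i).
have finj : set_inj D f.
  move=> i j; rewrite !inE => Di Dj [lev_ij l_ij].
  have [_ ri _] := Hlev i Di; have [_ rj _] := Hlev j Dj.
  have [_ ci] := Hl i Di; have [_ cj] := Hl j Dj.
  apply: Dtriv => //; exists (nth 0 (S (lev i)) (l i)); split; rewrite /eball/=.
    by rewrite enormB; apply: (le_trans ci); exact: ltW.
  by rewrite lev_ij l_ij enormB; apply: (le_trans cj); exact: ltW.
have sub : f @` D `<=` [set k | (k0 <= k)%N] `*`` (fun k => `I_(size (S k))).
  by move=> _ [i Di <-]; split => /=; [have [] := Hlev i Di|have [] := Hl i Di].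
apply: (@le_trans _ _ (\esum_(i in D) (g (f i).1)%:E)%E).
  apply: le_esum => i Di; rewrite lee_fin; have [_ _ ri] := Hlev i Di.
  have [ri0 _] := Dr i Di.
  by apply: ge0_ler_powR; rewrite ?nnegrE ?mulr_ge0 ?(ltW ri0) ?(ltW (half0 _))// ler_pM2l.
rewrite -(@esum_image _ _ _ D f (fun k => (g k.1)%:E))//.
apply: (le_trans (le_esum_subset _ sub)).
rewrite -(@esum_esum _ _ _ [set k | (k0 <= k)%N] (fun k => `I_(size (S k)))
  (fun k _ => (g k)%:E)); last by move=> *; rewrite lee_fin.
apply: (@le_trans _ _ (\esum_(k in [set k | (k0 <= k)%N])
    ((C * 2 `^ (tau + u))%:E * (q ^+ k)%:E))%E).
  apply: le_esum => k /= kk0; rewrite esum_const_ord// -EFinM lee_fin.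
  have [_ sz] := HS k kk0.
  apply: (le_trans (ler_wpM2r (g0 k) sz)).
  rewrite /g powRM ?(ltW (half0 _))// le_eqVlt; apply/orP; left; apply/eqP.
  have p2 m x : (2 ^- m : R) `^ x = 2 `^ (- (m%:R * x)).
    by rewrite -powR_invn// -powRrM mulNr.
  have two0 : (2 : R) != 0 by [].
  rewrite !p2 -powR_mulrn ?(ltW q0)// /q -powRrM -!mulrA; congr (_ * _).
  rewrite -!powRD ?two0 ?implybT//; congr (_ `^ _).
  by rewrite -natr1; ring.
apply: le_trans (_ : ((C * 2 `^ (tau + u) * (q ^+ k0 / (1 - q)))%:E <= _)%E).
  apply: esumZ_le; [by rewrite mulr_ge0 ?powR_ge0|exact: esum_geometric_tail|].
  by move=> k; rewrite lee_fin exprn_ge0 ?ltW.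
rewrite lee_fin; apply: le_trans k0M; rewrite /M le_eqVlt; apply/orP; left.
by apply/eqP; ring.
Qed.

End Dimensions.

(** * The dimension of a sum is at most the sum of the dimensions *)

Section PackingToCovering.
Context {R : realType} {n : nat}.
Implicit Types (E : set 'rV[R]_n) (u : R).

(** A packing by the largest possible number of balls of a given radius yields a
    covering: no further ball can be added, so every ball centred in [E] meets
    one of the packing. *)
Lemma packing_covering_bound u E : (packing_premeasure u E < +oo)%E ->
  covering_bound u E.
Proof.
move=> /ereal_inf_lt[_ [delta /= delta0 <-] Hlt].
have c0 := packing_content_ge0 u delta E.
have cfin : packing_content u delta E \is a fin_num by rewrite ge0_fin_numE.
pose M := fine (packing_content u delta E).
have M0 : 0 <= M by exact: fine_ge0.
pose k1 : R := n.+1%:R; have k10 : 0 < k1 by rewrite ltr0n.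
exists (M * k1 `^ u), delta; split; rewrite ?mulr_ge0 ?powR_ge0//.
move=> r /andP[r0 rdelta].
(* balls of radius [rho] that meet have their centres at distance at most [r],
   even when distances are estimated coordinate by coordinate *)
pose rho := r / (2 * k1).
have rho0 : 0 < rho by rewrite divr_gt0 ?mulr_gt0.
have rho2 : 2 * rho = r / k1 by rewrite /rho; field; exact: lt0r_neq0.
pose packed (s : seq 'rV[R]_n) := (forall c, c \in s -> E c) /\
  trivIset `I_(size s) (fun i => eball (nth 0 s i) rho).
have rho_pos : 0 < (2 * rho) `^ u by rewrite powR_gt0// mulr_gt0.
have packedM s : packed s -> (size s)%:R * (2 * rho) `^ u <= M.
  move=> [sE str]; rewrite -lee_fin fineK// -esum_const_ord ?powR_ge0//.
  apply: ereal_sup_ubound; exists `I_(size s), (nth 0 s), (fun=> rho); split => //.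
    by move=> i /= ?; apply: sE; exact: mem_nth.
  move=> i _; split => //; rewrite rho2; apply: le_trans (ltW rdelta).
  by rewrite ler_pdivrMr// ler_peMr ?ler1n// ltW.
pose P := fun k => `[< exists2 s, size s = k & packed s >].
have exP : exists k, P k.
  by exists 0%N; apply/asboolP; exists [::] => //; split => // i j.
have Pmax k : P k -> (k <= Num.truncn (M / (2 * rho) `^ u))%N.
  move=> /asboolP[s <- /packedM]; rewrite -ler_pdivlMr// => sM.
  by rewrite truncn_ge_nat// divr_ge0// powR_ge0.
case: (ex_maxnP exP Pmax) => k /asboolP[s sk sp] kmax.
exists s; split; last first.
  have := packedM s sp; rewrite -ler_pdivlMr// => /le_trans; apply.
  rewrite rho2 -mulrA ler_wpM2l// powRM ?(ltW r0) ?invr_ge0 ?(ltW k10)//.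
  by rewrite invfM powRN -(powR_inv1 (ltW k10)) -powRrM mulN1r powRN invrK mulrC.
move=> x Ex.
have nP : ~ packed (x :: s).
  move=> p; have : P k.+1 by apply/asboolP; exists (x :: s); rewrite //= sk.
  by move/kmax; rewrite ltnn.
have [c cs [p [xp cp]]] : exists2 c, c \in s & eball x rho `&` eball c rho !=set0.
  apply: contrapT => /forall2NP H; apply: nP; split.
    by move=> c; rewrite in_cons => /predU1P[->//|/sp.1].
  have dis i : (i < size s)%N -> ~ (eball x rho `&` eball (nth 0 s i) rho !=set0).
    by move=> ik; case: (H (nth 0 s i)) => // /negP; rewrite mem_nth.
  move=> [|i] [|j] //= ik jk.
  - by move/(dis j).
  - by rewrite setIC => /(dis i).
  - by move=> ij; congr S; exact: (sp.2 i j).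
exists c => //; rewrite /eball/=.
apply: (@le_trans _ _ (n%:R * (2 * rho))).
  apply: enorm_le => [|i]; first by rewrite mulr_ge0 ?ltW.
  have h1 := le_trans (coord_le_enorm _ i) xp.
  have h2 := le_trans (coord_le_enorm _ i) cp.
  move: h1 h2; rewrite !mxE !ler_norml => /andP[? ?] /andP[? ?].
  by apply/andP; split; lra.
rewrite rho2 mulrA ler_pdivrMr// mulrC ler_wpM2l ?(ltW r0)//.
by rewrite ler_nat.
Qed.

End PackingToCovering.

Section LebesgueNull.
Context {R : realType} {n : nat}.
Implicit Types (A B E U : set 'rV[R]_n) (u s : R).

Definition ball_weight (p : 'rV[R]_n * R) : \bar R := (`|p.2| ^+ n)%:E.

Lemma ball_weight_ge0 p : (0 <= ball_weight p)%E.
Proof. by rewrite lee_fin exprn_ge0. Qed.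

(** Comparable to Lebesgue's outer measure. *)
Definition volume : set 'rV[R]_n -> \bar R :=
  cover_content ball_weight (fun p => ball p.1 p.2).
Local Notation w0 := ball_weight_ge0.

Lemma powR_right_approx (d D s e : R) : 0 <= d -> 0 <= s -> 0 < e -> d < D ->
  exists d', [/\ d < d', d' < D & d' `^ s <= d `^ s + e].
Proof.
move=> d0; rewrite le_eqVlt => /predU1P[<-|s0] e0 dD.
  exists ((d + D) / 2); rewrite !powRr0; split; lra.
pose y := (d `^ s + e) `^ s^-1.
have ds0 : 0 <= d `^ s by exact: powR_ge0.
have dy : d < y.
  rewrite -[ltLHS](powRr1 d0) -(mulfV (lt0r_neq0 s0)) powRrM.
  apply: gt0_ltr_powR; rewrite ?invr_gt0 ?nnegrE ?ltrDl//.
  by rewrite addr_ge0// ltW.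
have d'0 : 0 <= Num.min y ((d + D) / 2) by rewrite le_min powR_ge0/=; lra.
exists (Num.min y ((d + D) / 2)); split.
- by rewrite lt_min dy/=; lra.
- by rewrite gt_min; apply/orP; right; lra.
apply: (@le_trans _ _ (y `^ s)).
  apply: ge0_ler_powR; rewrite ?nnegrE ?powR_ge0 ?(ltW s0)//.
  by rewrite ge_min lexx.
by rewrite /y -powRrM mulVf ?lt0r_neq0// powRr1// addr_ge0// ltW.
Qed.

Lemma ediam_ge0 U : (0 <= ediam U)%E.
Proof. by apply: ereal_sup_ubound; left. Qed.

Lemma enorm_le_ediam U x y : U x -> U y -> ((enorm (x - y))%:E <= ediam U)%E.
Proof.
by move=> Ux Uy; apply: ereal_sup_ubound; right; exists x => //; exists y.
Qed.

(** For [d'] slightly larger than the diameter of [U], the sum [U + E] is covered by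
    [C * d' ^ (- u)] balls of radius [3 * d']. *)
Lemma volume_small_sum E u s (C delta : R) U : 0 <= C -> 0 <= s ->
  s + u <= n%:R -> delta <= 1 ->
  (forall r, 0 < r < delta -> exists l : seq 'rV[R]_n,
    E `<=` \bigcup_(c in [set` l]) eball c r /\ (size l)%:R <= C * r `^ (- u)) ->
  (ediam U < delta%:E)%E ->
  (volume (minkowski_sum U E) <= (C * 3 ^+ n)%:E * (ediam U `^ s))%E.
Proof.
move=> C0 s0 sun delta1 HE Udelta.
have dfin : ediam U \is a fin_num.
  by rewrite ge0_fin_numE ?ediam_ge0//; apply: lt_trans Udelta _; exact: ltry.
have dE : ediam U = (fine (ediam U))%:E by rewrite fineK.
set d := fine (ediam U) in dE.
have d0 : 0 <= d by rewrite -lee_fin -dE ediam_ge0.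
have dd : d < delta by rewrite -lte_fin -dE.
have C30 : 0 <= C * 3 ^+ n by rewrite mulr_ge0// exprn_ge0.
rewrite dE poweR_EFin -EFinM.
have [[x0 Ux0]|U0] := pselect (U !=set0); last first.
  rewrite (_ : minkowski_sum U E = set0).
    by rewrite /volume (cover_content0 w0) lee_fin mulr_ge0 ?powR_ge0.
  by apply/nonemptyPn => -[_ [x Ux _]]; apply: U0; exists x.
apply/lee_addgt0Pr => e e0.
have e1 : 0 < e / (C * 3 ^+ n + 1) by rewrite divr_gt0// ltr_wpDl.
have [d' [dd' d'delta d's]] := powR_right_approx d0 s0 e1 dd.
have d'0 : 0 < d' by exact: le_lt_trans dd'.
have [l [El sl]] := HE d' (introT andP (conj d'0 d'delta)).
apply: (@le_trans _ _ (C * 3 ^+ n * d' `^ s)%:E); last first.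
  rewrite -EFinD lee_fin; apply: (le_trans (ler_wpM2l C30 d's)).
  rewrite mulrDr lerD2l mulrCA ler_piMr ?(ltW e0)// ler_pdivrMr ?ltr_wpDl//.
  by rewrite mul1r lerDl.
have cov : minkowski_sum U E `<=`
    \bigcup_(i : 'I_(size l)) ball (x0 + nth 0 l i) (3 * d').
  move=> _ [x Ux [y /El[c /= cl yc] <-]].
  have il : (index c l < size l)%N by rewrite index_mem.
  exists (Ordinal il) => //=; rewrite nth_index// ball_rVE/=.
  have h1 : `|x - x0| <= d.
    apply: (le_trans (norm_le_enorm _)); rewrite -lee_fin -dE.
    exact: enorm_le_ediam.
  have h2 := le_trans (norm_le_enorm _) yc.
  rewrite distrC (_ : x + y - _ = (x - x0) + (y - c)); last first.
    by rewrite opprD addrACA.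
  by apply: (le_lt_trans (ler_normD _ _)); lra.
apply: (le_trans (cover_content_sum w0 cov)).
apply: (@le_trans _ _ (\sum_(i < size l) ((3 * d') ^+ n)%:E)%E).
  apply: lee_sum => i _.
  have := cover_content_cell w0 (x0 + nth 0 l i, 3 * d') (fun x h => h).
  by rewrite /ball_weight/= ger0_norm// mulr_ge0// ltW.
rewrite sumEFin sumr_const card_ord lee_fin -[_ *+ _]mulr_natl exprMn mulrCA.
rewrite [leRHS]mulrAC mulrC ler_wpM2r ?exprn_ge0//.
rewrite -powR_mulrn ?(ltW d'0)//.
apply: (le_trans (ler_wpM2r (powR_ge0 _ _) sl)).
rewrite -mulrA ler_wpM2l// -powRD ?(lt0r_neq0 d'0) ?implybT//.
apply: ger_powR; first by rewrite d'0 (ltW (lt_le_trans d'delta delta1)).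
by lra.
Qed.

(** Each member of a fine covering of [A] is summed with [E] at a cost comparable to
    its diameter to the power [s]. *)
Lemma volume_sum0 A E u s : 0 <= s -> s + u <= n%:R -> covering_bound u E ->
  hausdorff_measure s A = 0%E -> volume (minkowski_sum A E) = 0%E.
Proof.
move=> s0 sun [C [delta [C0 delta0 HE]]] HA.
pose d1 := Num.min delta 1.
have d10 : 0 < d1 by rewrite lt_min delta0 ltr01.
apply/le_anti; rewrite (cover_content_ge0 w0) andbT.
apply/lee_addgt0Pr => e e0; rewrite add0e.
have C30 : 0 <= C * 3 ^+ n by rewrite mulr_ge0// exprn_ge0.
have : (hausdorff_content s (d1 / 2) A < (e / (C * 3 ^+ n + 1))%:E)%E.
  apply: (@le_lt_trans _ _ 0%E); last by rewrite lte_fin divr_gt0// ltr_wpDl.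
  rewrite -HA; apply: ereal_sup_ubound; exists (d1 / 2) => //=.
  by rewrite divr_gt0.
move=> /ereal_inf_lt[_ [D [U [AU Ud ->]]] Ue].
have cov : minkowski_sum A E `<=` \bigcup_(i in D) minkowski_sum (U i) E.
  by move=> _ [x /AU[i Di Ux] [y Ey <-]]; exists i => //; exists x => //; exists y.
apply: (le_trans (cover_content_bigcup w0 cov)).
apply: (@le_trans _ _ (\esum_(i in D) ((C * 3 ^+ n)%:E * (ediam (U i) `^ s)))%E).
  apply: le_esum => i Di; apply: (volume_small_sum (delta := d1)) => //.
  - exact: sun.
  - by rewrite ge_min lexx orbT.
  - move=> r /andP[r0 rd]; apply: HE; rewrite r0/=; apply: (lt_le_trans rd).
    by rewrite ge_min lexx.
  - apply: (le_lt_trans (Ud i Di)); rewrite lte_fin.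
    by rewrite ltr_pdivrMr// mulr_natr mulr2n ltrDl.
apply: le_trans (esumZ_le C30 (ltW Ue) _) _; first by move=> i; exact: poweR_ge0.
rewrite lee_fin mulrCA ler_piMr ?(ltW e0)// ler_pdivrMr ?ltr_wpDl// mul1r.
by rewrite lerDl.
Qed.

Lemma count_progression N (a h rho : R) : 0 < h ->
  \sum_(k < N) ((`|a + h * k%:R| < rho)%R : nat)%:R <= 2 * `|rho| / h + 1 :> R.
Proof.
move=> h0; pose P k := `|a + h * k%:R| < rho.
have rhs0 : 0 <= 2 * `|rho| / h by rewrite divr_ge0 ?mulr_ge0// ltW.
rewrite -natr_sum -(big_mkord xpredT (fun k => nat_of_bool (P k))).
rewrite (_ : (\sum_(0 <= k < N) P k)%N = size [seq k <- index_iota 0 N | P k]); last first.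
  by rewrite size_filter -sum1_count [RHS]big_mkcond; apply: eq_bigr => k _; case: (P k).
set s := [seq k <- _ | _].
have [[k1 Pk1]|nP] := pselect (exists k, P k); last first.
  suff -> : s = [::] by rewrite addr_ge0.
  apply/eqP; rewrite -[_ == _]negbK -has_filter.
  by apply/negP => /hasP[k _ Pk]; apply: nP; exists k.
case: (ex_minnP (ex_intro P k1 Pk1)) => k0 Pk0 kmin.
pose m := Num.truncn (2 * `|rho| / h).
apply: (@le_trans _ _ m.+1%:R); last first.
  by rewrite -natr1 lerD2r /m truncn_le.
rewrite ler_nat -(size_iota k0 m.+1); apply: uniq_leq_size.
  by rewrite filter_uniq// iota_uniq.
move=> k; rewrite mem_filter mem_iota => /andP[Pk _].
have k0k := kmin k Pk; rewrite k0k/= addnS ltnS -leq_subLR /m truncn_ge_nat//.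
rewrite ler_pdivlMr// natrB//.
have rho0 : 0 < rho by exact: le_lt_trans Pk.
rewrite gtr0_norm//; move: Pk Pk0; rewrite /P !ltr_norml => /andP[_ h1] /andP[h2 _].
by rewrite mulrC mulrBr; lra.
Qed.

(** Of the [N ^ n] points of a regular grid in a cube, a ball of radius [rho]
    contains at most a proportion of order [rho ^ n], once the grid is fine. *)
Lemma volume_cube_gt0 x0 e : 0 < e -> (0 < volume (cube x0 e))%E.
Proof.
move=> e0; rewrite lt_neqAle (cover_content_ge0 w0) andbT eq_sym.
apply/negP => /eqP vol0.
pose k : R := (4 / e) ^+ n.
have k0 : 0 < k by rewrite exprn_gt0// divr_gt0.
have : (volume (cube x0 e) < (k^-1)%:E)%E by rewrite vol0 lte_fin invr_gt0.
move=> /cover_content_lt[D [xD Dk]].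
have := @compact_cube R n x0 e; rewrite compact_cover.
move=> /(_ _ D (fun p => ball p.1 p.2) _ xD)[p _|D' D'D cov].
  exact: ball_open.
have D'k : \sum_(p <- enum_fset D') `|p.2| ^+ n < k^-1.
  rewrite -lte_fin -sumEFin; apply: le_lt_trans Dk.
  apply: ereal_sup_ubound; exists [set` D'].
    split; [exact: finite_fset|move=> p /= pD'].
    by apply: set_mem; exact: D'D.
  by rewrite fsbig_finite//= set_fsetK.
(* the step of the grid is at most the radius of each ball *)
pose N := (\max_(p <- enum_fset D') (Num.truncn (e / `|p.2|)).+1).+1.
have N0 : 0 < N%:R :> R by rewrite ltr0n.
pose h := e / N%:R; have h0 : 0 < h by rewrite divr_gt0.
pose hit (p : 'rV[R]_n * R) (l : 'I_n) (i : 'I_N) : R :=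
  ((`|(x0 - p.1) ord0 l + h * i%:R| < p.2)%R : nat)%:R.
have hit0 p l i : 0 <= hit p l i by exact: ler0n.
have hitk p : p \in enum_fset D' -> \prod_l \sum_i hit p l i <= ((4 / e) * N%:R * `|p.2|) ^+ n.
  move=> pD'; set X := _ * _ * _.
  have -> : X ^+ n = \prod_(l < n) X by rewrite prodr_const card_ord.
  rewrite {}/X.
  have [p0|p0] := leP p.2 0.
    apply: ler_prod => l _; rewrite sumr_ge0//= big1 => [|i _].
      by apply: mulr_ge0 => //; apply: mulr_ge0 => //; rewrite divr_ge0// ltW.
    by rewrite /hit ltNge (le_trans p0).
  apply: ler_prod => l _; rewrite sumr_ge0//=.
  apply: (le_trans (count_progression _ _ _ h0)).
  have pN : 1 <= N%:R / e * `|p.2|.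
    rewrite -ler_pdivrMr ?normr_gt0 ?gt_eqF// ler_pdivlMr// mul1r mulrC.
    apply: ltW; apply: (lt_le_trans (truncnS_gt _)); rewrite ler_nat.
    by apply: leqW; apply: (@leq_bigmax_seq _ _ xpredT).
  rewrite /h (_ : 2 * `|p.2| / (e / N%:R) = 2 * (N%:R / e * `|p.2|)); last first.
    by field; rewrite !gt_eqF.
  by rewrite (_ : 4 / e * N%:R * `|p.2| = 4 * (N%:R / e * `|p.2|)); [lra|ring].
have : (N ^ n)%:R <= \sum_(p <- enum_fset D') ((4 / e) * N%:R * `|p.2|) ^+ n.
  apply: (@le_trans _ _ (\sum_(p <- enum_fset D') \prod_l \sum_i hit p l i)).
    under eq_bigr do rewrite bigA_distr_bigA/=.
    rewrite exchange_big/=.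
    have -> : (N ^ n)%:R = \sum_(f : {ffun 'I_n -> 'I_N}) 1 :> R.
      by rewrite sumr_const card_ffun !card_ord.
    apply: ler_sum => f _.
    have : cube x0 e (\row_l (x0 ord0 l + h * (f l)%:R)).
      move=> l; rewrite mxE lerDl lerD2l mulr_ge0 ?(ltW h0)//=.
      rewrite /h -mulrA -[leRHS]mulr1 ler_pM2l// mulrC ler_pdivrMr// mul1r.
      by rewrite ler_nat ltnW.
    move=> /cov[p /= pD' xp]; rewrite (big_rem p)//= -[leLHS]addr0 lerD//; last first.
      by apply: sumr_ge0 => q _; apply: prodr_ge0 => l _.
    rewrite big1// => l _; rewrite /hit.
    move: xp; rewrite ball_rVE/= distrC => xp.
    have := le_lt_trans (coord_le_norm _ l) xp; rewrite !mxE => {}xp.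
    by rewrite (_ : _ + _ = x0 ord0 l + h * (f l)%:R - p.1 ord0 l) ?xp//; ring.
  by rewrite !big_seq; apply: ler_sum => p pD'; exact: hitk.
apply/negP; rewrite -ltNge.
under eq_bigr do rewrite exprMn exprMn.
rewrite -mulr_sumr natrX -ltr_pdivlMl ?mulr_gt0 ?exprn_gt0 ?divr_gt0//.
by rewrite invfM -mulrA mulVf ?mulr1// expf_neq0// gt_eqF.
Qed.

Lemma hausdorff_dim_ge0 A : (0 <= hausdorff_dim A)%E.
Proof. by apply: le_ereal_inf_tmp => _ [s [s0 _] <-]; rewrite lee_fin. Qed.

(** If [A] is null for the Hausdorff measure of exponent [s] and [B] for the packing
    measure of exponent [u], then [B] splits into countably many pieces with
    covering bounds of exponent [u]. When [s + u <= n], the sum of [A] with each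
    piece has volume zero, and so has [A + B], which then contains no cube. *)
Theorem sum_dim_ge A B : interior (minkowski_sum A B) !=set0 ->
  (n%:R%:E <= hausdorff_dim A + packing_dim B)%E.
Proof.
move=> [x0 /nbhs_ballP[e /= e0 xe]].
have vol : (0 < volume (minkowski_sum A B))%E.
  apply: (lt_le_trans (volume_cube_gt0 x0 (divr_gt0 e0 (ltr0n R 2)))).
  apply: le_cover_content => x xc; apply: xe; rewrite ball_rVE/=.
  apply: norm_lt_coord => // l; have := xc l; rewrite !mxE ltr_norml => /andP[? ?].
  by apply/andP; split; lra.
have key u s : 0 <= s -> hausdorff_measure s A = 0%E -> 0 <= u ->
    packing_measure u B = 0%E -> n%:R < s + u.
  move=> s0 HA u0 PB; rewrite ltNge; apply/negP => sun.
  have : (packing_measure u B < 1%:E)%E by rewrite PB lte_fin.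
  move=> /ereal_inf_lt[_ [E [BE ->]] E1].
  have pre0 i : (0 <= packing_premeasure u (E i))%E.
    exact: packing_premeasure_ge0.
  have Ei i : covering_bound u (E i).
    apply: packing_covering_bound; apply: le_lt_trans (ltry 1).
    apply: le_trans (ltW E1).
    rewrite nneseries_esumT//; exact: (esum_le_term (a := fun i => packing_premeasure u (E i))).
  suff v0 : volume (minkowski_sum A B) = 0%E by move: vol; rewrite v0 ltxx.
  apply: (cover_content_bigcup0 w0 (F := fun i => minkowski_sum A (E i))).
    by move=> _ [a Aa [b /BE[i _ Eb] <-]]; exists i => //; exists a => //; exists b.
  by move=> i; exact: (volume_sum0 s0 sun (Ei i) HA).
rewrite leNgt; apply/negP => lt.
have H0 := hausdorff_dim_ge0 A.
have P0 : (0 <= packing_dim B)%E.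
  by apply: le_ereal_inf_tmp => _ [s [s0 _] <-]; rewrite lee_fin.
have Hfin : hausdorff_dim A \is a fin_num.
  rewrite ge0_fin_numE//; apply: le_lt_trans (ltry n%:R).
  by apply: le_trans (ltW lt); rewrite leeDl.
have Pfin : packing_dim B \is a fin_num.
  rewrite ge0_fin_numE//; apply: le_lt_trans (ltry n%:R).
  by apply: le_trans (ltW lt); rewrite leeDr.
set x := hausdorff_dim A in lt Hfin *; set y := packing_dim B in lt Pfin *.
move: lt; rewrite -(fineK Hfin) -(fineK Pfin) -EFinD lte_fin => lt.
pose d := (n%:R - (fine x + fine y)) / 2.
have d0 : 0 < d by rewrite divr_gt0// subr_gt0.
have : (x < (fine x + d)%:E)%E by rewrite -[ltLHS](fineK Hfin) lte_fin ltrDl.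
move=> /ereal_inf_lt[_ [s [s0 Hs] <-]]; rewrite lte_fin => sx.
have : (y < (fine y + d)%:E)%E by rewrite -[ltLHS](fineK Pfin) lte_fin ltrDl.
move=> /ereal_inf_lt[_ [u [u0 Hu] <-]]; rewrite lte_fin => uy.
have := key u s s0 Hs u0 Hu; rewrite ltNge => /negP; apply.
by move: sx uy; rewrite /d; lra.
Qed.

End LebesgueNull.

(** * Small complements of a set of given Hausdorff dimension *)

Section ContentHausdorff.
Context {R : realType} {n : nat}.
Implicit Types (A B K : set 'rV[R]_n) (t tau u : R).

Lemma ediam_cell (b : nat) (p : nat * 'rV[int]_n) : (0 < b)%N ->
  (ediam (cell b p : set 'rV[R]_n) <= (n%:R * b%:R ^- p.1 : R)%:E)%E.
Proof.
move=> b_gt0; have b0 : (0 : R) < b%:R ^+ p.1 by rewrite exprn_gt0// ltr0n.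
apply: ge_ereal_sup => _ [->|[x xp [y yp] <-]].
  by rewrite lee_fin mulr_ge0// invr_ge0 ltW.
rewrite lee_fin; apply: enorm_le => [|i]; first by rewrite invr_ge0 ltW.
have := xp; have := yp; rewrite /cell/= => /rowP/(_ i) + /rowP/(_ i).
rewrite !mxE => yi xi; have := floor_itv (b%:R ^+ p.1 * x ord0 i).
have := floor_itv (b%:R ^+ p.1 * y ord0 i); rewrite xi yi rmorphD/= rmorph1.
move=> /andP[h1 h2] /andP[h3 h4]; rewrite -(ler_pM2l b0) mulfV ?gt_eqF//.
rewrite -{1}(gtr0_norm b0) -normrM mulrBr ler_norml.
by apply/andP; split; lra.
Qed.

(** A covering of small total charge consists of small cells only, so nullity for
    the content and for the Hausdorff measure agree. *)
Lemma content0_hausdorff0 (b : nat) t A : (1 < b)%N -> 0 < t ->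
  content b (b%:R `^ (- t)) A = 0%E -> hausdorff_measure t A = 0%E.
Proof.
move=> b_gt1 t0 cA.
have b1 : (1 : R) < b%:R by rewrite ltr1n.
have b0 : (0 : R) < b%:R by exact: lt_trans b1.
have content_ge0 delta : (0 <= hausdorff_content t delta A)%E.
  apply: le_ereal_inf_tmp => _ [D [U [_ _ ->]]].
  by apply: esum_ge0 => i _; exact: poweR_ge0.
apply/le_anti/andP; split; last first.
  by apply: le_trans (content_ge0 1) _; apply: ereal_sup_ubound; exists 1 => //=.
apply: ge_ereal_sup => _ [delta /= delta0 <-].
apply/lee_addgt0Pr => e e0; rewrite add0e.
pose k : R := n.+1%:R; have k0 : 0 < k by rewrite ltr0n.
have kt0 : 0 < k `^ t by rewrite powR_gt0.
pose eta := Num.min ((delta / k) `^ t) (e / k `^ t).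
have eta0 : 0 < eta by rewrite lt_min powR_gt0 divr_gt0.
have : (content b (b%:R `^ (- t)) A < eta%:E)%E by rewrite cA lte_fin.
move=> /cover_content_lt[D [AD Deta]].
have w0 p : (0 <= cell_weight (n := n) (b%:R `^ (- t) : R) p)%E.
  by rewrite lee_fin exprn_ge0// powR_ge0.
have wR m : (b%:R `^ (- t)) ^+ m = (b%:R ^- m) `^ t :> R.
  rewrite -powR_mulrn ?powR_ge0// -(powR_invn m (ltW b0)) -!powRrM.
  by congr (_ `^ _); ring.
have wE (p : nat * 'rV[int]_n) :
    cell_weight (b%:R `^ (- t) : R) p = (((b%:R ^- p.1) `^ t : R)%:E).
  by rewrite /cell_weight wR.
have wt p : D p -> (b%:R ^- p.1 : R) `^ t < eta.
  move=> Dp; rewrite -lte_fin -wE; apply: le_lt_trans Deta.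
  exact: (esum_le_term w0).
pose U i := if @unpickle (nat * 'rV[int]_n)%type i is Some p
  then cell (R := R) b p else set0.
have inv0 m : (0 : R) <= b%:R ^- m by rewrite invr_ge0 exprn_ge0// ltW.
have diam (p : nat * 'rV[int]_n) : (ediam (cell b p : set 'rV[R]_n) <= (k * b%:R ^- p.1 : R)%:E)%E.
  apply: (le_trans (ediam_cell p (ltnW b_gt1))); rewrite lee_fin.
  by rewrite ler_wpM2r// ler_nat.
apply: (@le_trans _ _ (\esum_(i in pickle @` D) (ediam (U i) `^ t))%E).
  apply: ereal_inf_lbound; exists (pickle @` D), U; split => //.
    by move=> x /AD[p Dp px]; exists (pickle p); [exists p|rewrite /U pickleK].
  move=> _ [p Dp <-]; rewrite /U pickleK; apply: (le_trans (diam p)).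
  rewrite lee_fin mulrC -ler_pdivlMr//.
  rewrite leNgt; apply/negP => lt; have := wt p Dp.
  rewrite lt_min => /andP[+ _]; apply/negP; rewrite -leNgt.
  by apply: ge0_ler_powR; rewrite ?nnegrE ?divr_ge0 ?(ltW t0) ?(ltW delta0) ?(ltW k0) ?(ltW lt).
rewrite (@esum_image _ _ _ D (@pickle _) (fun i => ediam (U i) `^ t)%E); last first.
  by move=> x y _ _; exact: (pcan_inj pickleK).
apply: (@le_trans _ _ (\esum_(p in D) ((k `^ t)%:E *
    cell_weight (b%:R `^ (- t) : R) p))%E).
  apply: le_esum => p Dp; rewrite /U pickleK wE -EFinM -powRM ?(ltW k0)//.
  rewrite -poweR_EFin; apply: gt0_ler_poweR (diam p); rewrite ?(ltW t0)//.
    by rewrite in_itv/= leey ediam_ge0.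
  by rewrite in_itv/= leey lee_fin mulr_ge0// ltW.
apply: (le_trans (esumZ_le (ltW kt0) (ltW Deta) w0)).
by rewrite lee_fin mulrC -ler_pdivlMr// ge_min lexx orbT.
Qed.

Lemma powR_large_base (e M : R) : 0 < e -> exists b0 : nat, forall b : nat,
  (b0 <= b)%N -> M <= b%:R `^ e.
Proof.
move=> e0; pose y := (Num.max M 0) `^ e^-1.
have M0 : 0 <= Num.max M 0 by rewrite le_max lexx orbT.
exists (Num.truncn y).+1 => b yb.
apply: (@le_trans _ _ (y `^ e)).
  by rewrite /y -powRrM mulVf ?lt0r_neq0// powRr1// le_max lexx.
apply: ge0_ler_powR; rewrite ?nnegrE ?powR_ge0 ?(ltW e0)//.
by apply: le_trans (ltW (truncnS_gt y)) _; rewrite ler_nat.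
Qed.

Definition unit_box : set 'rV[R]_n := [set x | forall l, 0 <= x ord0 l < 1].

(** A single point of [A] is enough, with the full tree; the base is large to
    absorb the factor [2 ^ n] by which expansion exceeds a subdivision. *)
Lemma sparse_complement_dim0 A tau : A !=set0 -> n%:R < tau ->
  exists B, [/\ compact B, unit_box `<=` minkowski_sum A B, covering_bound tau B &
    0 <= tau].
Proof.
move=> [a0 Aa0] ntau.
have tn : 0 < tau - n%:R by rewrite subr_gt0.
have [b0 Hb0] := powR_large_base (2 ^+ n) tn.
pose b := maxn b0 2; have b_gt1 : (1 < b)%N by rewrite leq_max orbT.
have bn : 2 ^+ n <= (b%:R : R) `^ (tau - n%:R) by apply: Hb0; exact: leq_maxl.
have bp : (0 : R) < b%:R by rewrite ltr0n ltnW.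
pose z0 : 'rV[int]_n := key b 0 a0.
pose V i := iter i (expand b) [:: - z0].
pose w j (z : 'rV[int]_n) : R := ((key b j a0 == z) : nat)%:R.
have hits i a : box b (0 + i) a ->
    exists2 v, v \in V i & exists2 y, [set a0] y & key b (0 + i) y = a - v.
  move=> ai; rewrite add0n in ai *.
  have w_ge0 j z : 0 <= w j z by exact: ler0n.
  have w_child j z : w j z <= \sum_(d : 'rV['I_b]_n) w j.+1 (child z d).
    rewrite /w; case: eqP => [<-|_]; last by rewrite sumr_ge0.
    have [d ->] := key_has_child (ltnW b_gt1) j a0.
    by rewrite (bigD1 d)//= eqxx lerDl sumr_ge0.
  have := full_tree_sum b_gt1 w_ge0 w_child z0 ai.
  rewrite {1}/w eqxx => sum1.
  apply: contrapT => nv; move: sum1; apply/negP; rewrite -ltNge.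
  rewrite big_seq big1 ?ltr01// => v vV; rewrite /w; case: eqP => // E.
  by case: nv; exists v => //; exists a0.
have size_V i : (size (V i))%:R <= 1 * (b%:R `^ tau : R) ^+ i.
  rewrite mul1r; apply: (@le_trans _ _ ((2 * b)%:R ^+ n ^+ i)).
    rewrite -!natrX ler_nat; elim: i => [//|i IH].
    by apply: (leq_trans (size_expand _ _)); rewrite expnSr leq_mul2r IH orbT.
  apply: lerXn2r; rewrite ?nnegrE ?exprn_ge0 ?powR_ge0//.
  rewrite natrM exprMn -(subrK n%:R tau) powRD ?(lt0r_neq0 bp) ?implybT//.
  by rewrite powR_mulrn ?(ltW bp)// ler_wpM2r ?exprn_ge0// ltW.
have V_exp i : {subset V i.+1 <= expand b (V i)} by [].
exists (tree_set b 0 V); split.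
- exact: compact_tree_set.
- move=> x /(tree_set_hits b_gt1 V_exp (@compact_set1 _ a0) hits).
  by move=> [_ -> [y By <-]]; exists a0 => //; exists y.
- exact: (tree_set_covering b_gt1 hits ler01 size_V).
- exact: (tree_exponent_ge0 b_gt1 hits ler01 size_V).
Qed.

(** Apply [sparse_tree] to the masses [content (K `&` cell)] of a compact subset [K]
    of [A] of positive content. With [beta = b `^ (- t)] the levels grow by the
    factor [16 * 2 ^ n * b `^ (n - t)], and the constant is absorbed into
    [b `^ tau] by a large base. *)
Theorem sparse_complement A t tau : analytic A -> 0 < t ->
  hausdorff_measure t A <> 0%E -> n%:R - t < tau ->
  exists B, [/\ compact B, unit_box `<=` minkowski_sum A B, covering_bound tau B &
    0 <= tau].
Proof.
move=> anA t0 HA ttau.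
have gain : 0 < tau - (n%:R - t) by rewrite subr_gt0.
have [b0 Hb0] := powR_large_base (16 * 2 ^+ n) gain.
have [b8 Hb8] := powR_large_base 8 t0.
pose b := maxn (maxn b0 b8) 2; have b_gt1 : (1 < b)%N by rewrite leq_max orbT.
have bn : 16 * 2 ^+ n <= (b%:R : R) `^ (tau - (n%:R - t)).
  by apply: Hb0; rewrite leq_max leq_maxl.
have bt : 8 <= (b%:R : R) `^ t by apply: Hb8; rewrite leq_max leq_maxr.
have bp : (0 : R) < b%:R by rewrite ltr0n ltnW.
pose beta : R := b%:R `^ (- t).
have beta0 : 0 < beta by exact: powR_gt0.
have beta8 : 8 * beta <= 1 by rewrite /beta powRN ler_pdivrMr ?powR_gt0// mul1r.
have beta01 : 0 < beta < 1 by rewrite beta0/=; lra.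
have w0 := @cell_weight_ge0 R n beta beta01.
have pos (E : set 'rV[R]_n) : (0 < content b beta E)%E ->
    exists z, (0 < content b beta (E `&` cell b (0%N, z)))%E.
  move=> E0; apply: contrapT => /forallNP H; move: E0; apply/negP.
  rewrite -leNgt le_eqVlt; apply/orP; left; apply/eqP.
  have := @cover_content_bigcup0 _ _ _ _ (cell b) w0 _
    (fun z : 'rV[int]_n => E `&` cell b (0%N, z)) E.
  apply.
    by move=> x Ex; exists (key b 0 x).
  move=> z; apply/le_anti; rewrite (cover_content_ge0 w0) andbT leNgt.
  exact/negP/H.
have [z zA] : exists z, (0 < content b beta (A `&` cell b (0%N, z)))%E.
  apply: pos; rewrite lt_neqAle content_ge0// andbT eq_sym.
  by apply/eqP => cA0; apply: HA; exact: content0_hausdorff0 b_gt1 t0 cA0.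
have [K [Kco KA /pos[z0 zK]]] := analytic_compact_content (ltnW b_gt1) beta01 anA zA.
pose w j z : R := fine (content b beta (K `&` cell b (j, z))).
have wE j z' : (w j z')%:E = content b beta (K `&` cell b (j, z')).
  by rewrite fineK// content_cell_fin.
have [||||j0 [V [N0 [N00 V_exp V_size V_sum]]]] :=
    @sparse_tree R n b b_gt1 beta beta0 beta8 w _ _ _ z0.
- by move=> j z'; rewrite -lee_fin wE content_ge0.
- by move=> j z'; rewrite -lee_fin wE; exact: (content_cell _ beta01 (j, z')).
- move=> j z'; rewrite -lee_fin wE -sumEFin.
  apply: (le_trans (content_children_ge (ltnW b_gt1) beta01 _ _ _)).
  by apply: lee_sum => d _; rewrite wE.
- by rewrite -lte_fin wE.
have hits i a : box b (j0 + i) a ->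
    exists2 v, v \in V i & exists2 y, K y & key b (j0 + i) y = a - v.
  move=> /V_sum sum0; apply: contrapT => nv; move: sum0; apply/negP; rewrite -leNgt.
  rewrite big_seq big1 // => v vV; rewrite /w (_ : _ `&` _ = set0).
    by rewrite /content (cover_content0 w0).
  apply/nonemptyPn => -[y [Ky yE]]; apply: nv; exists v => //; exists y => //.
have size_V i : (size (V i))%:R <= N0 * (b%:R `^ tau : R) ^+ i.
  apply: (le_trans (V_size i)); rewrite ler_wpM2l//.
  apply: lerXn2r; rewrite ?nnegrE ?powR_ge0 ?mulr_ge0 ?exprn_ge0 ?(ltW beta0)//.
  have -> : b%:R `^ tau = b%:R `^ (tau - (n%:R - t)) * (b%:R ^+ n * beta).
    rewrite -powR_mulrn ?(ltW bp)// /beta -!powRD ?(lt0r_neq0 bp) ?implybT//.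
    by congr (_ `^ _); ring.
  rewrite natrM exprMn.
  have -> : 16 * beta * (2 ^+ n * b%:R ^+ n) = 16 * 2 ^+ n * (b%:R ^+ n * beta).
    by ring.
  by rewrite ler_wpM2r// mulr_ge0 ?exprn_ge0 ?(ltW beta0) ?(ltW bp).
exists (tree_set b j0 V); split.
- exact: compact_tree_set.
- move=> x /(tree_set_hits b_gt1 V_exp Kco hits)[a Ka [y By <-]].
  by exists a; [exact: KA|exists y].
- exact: (tree_set_covering b_gt1 hits N00 size_V).
- exact: (tree_exponent_ge0 b_gt1 hits N00 size_V).
Qed.

End ContentHausdorff.

(** * The codimension formulas *)

Section Codimension.
Context {R : realType} {n : nat}.
Implicit Types (A B : set 'rV[R]_n) (tau u : R).

Lemma ereal_between (x y : \bar R) : (x < y)%E ->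
  exists r : R, (x < r%:E)%E /\ (r%:E < y)%E.
Proof.
case: x y => [x| |] [y| |] //=.
- rewrite lte_fin => xy; exists ((x + y) / 2); rewrite !lte_fin.
  by split; lra.
- by move=> _; exists (x + 1); rewrite lte_fin ltry; split => //; lra.
- by move=> _; exists (y - 1); rewrite lte_fin ltNyr; split => //; lra.
- by move=> _; exists 0; rewrite ltry ltNyr.
Qed.

(** A nonempty set needs at least one ball at each scale. *)
Lemma covering_bound_ge0 tau B : B !=set0 -> covering_bound tau B -> 0 <= tau.
Proof.
move=> [x Bx] [C [delta [C0 delta0 HB]]].
rewrite leNgt; apply/negP => tau0.
have C1 : 0 < (C + 1)^-1 by rewrite invr_gt0 ltr_wpDl.
pose r := Num.min (delta / 2) ((C + 1)^-1 `^ (- tau)^-1).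
have r0 : 0 < r by rewrite lt_min divr_gt0// powR_gt0.
have rd : r < delta by rewrite gt_min ltr_pdivrMr// mulr_natr mulr2n ltrDl delta0.
have [s [Bs sz]] := HB r (introT andP (conj r0 rd)).
have [c cs _] := Bs x Bx.
have s1 : (1 : R) <= (size s)%:R by rewrite ler1n; case: (s) cs.
have ntau0 : 0 < - tau by rewrite oppr_gt0.
have rt : r `^ (- tau) <= (C + 1)^-1.
  have -> : (C + 1)^-1 = ((C + 1)^-1 `^ (- tau)^-1) `^ (- tau).
    by rewrite -powRrM mulVf ?lt0r_neq0// powRr1// ltW.
  apply: ge0_ler_powR; rewrite ?nnegrE ?powR_ge0 ?(ltW ntau0) ?(ltW r0)//.
  by rewrite /r ge_min lexx orbT.
have := le_trans s1 (le_trans sz (ler_wpM2l C0 rt)).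
by rewrite ler_pdivlMr ?ltr_wpDl// mul1r gerDl lt_geF ?ltr01.
Qed.

Lemma packing_dim_le B u (E : nat -> set 'rV[R]_n) : 0 <= u ->
  B `<=` \bigcup_i E i -> (forall i, packing_premeasure u (E i) = 0%E) ->
  (packing_dim B <= u%:E)%E.
Proof.
move=> u0 BE E0; apply: ereal_inf_lbound; exists u => //; split => //.
apply/le_anti/andP; split.
  apply: ereal_inf_lbound; exists E; split => //.
  by rewrite eseries0// => i _ _; rewrite E0.
apply: le_ereal_inf_tmp => _ [F [_ ->]]; apply: nneseries_ge0 => i _ _.
exact: packing_premeasure_ge0.
Qed.

Lemma packing_dim_le_minkowski B : B !=set0 ->
  (packing_dim B <= upper_minkowski_dim B)%E.
Proof.
move=> B0; rewrite leNgt; apply/negP => /ereal_between[tau [mtau taup]].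
have cb := upper_minkowski_dim_lt mtau.
have tau0 := covering_bound_ge0 B0 cb.
have [u [tauu up]] := ereal_between taup; rewrite lte_fin in tauu.
have u0 : 0 <= u by exact: le_trans (ltW tauu).
move: up; apply/negP; rewrite -leNgt.
apply: (packing_dim_le (E := fun=> B)) => // [x Bx|_]; first by exists 0%N.
exact: packing_premeasure0 cb tauu u0.
Qed.

(** When [tau <= n], there is an exponent [t > 0] with
    [n - tau < t < hausdorff_dim A], and [A] is not null for it. *)
Lemma sparse_complement_dim A tau : borel A -> A !=set0 ->
  (n%:R%:E - hausdorff_dim A < tau%:E)%E ->
  exists B, [/\ compact B, unit_box `<=` minkowski_sum A B, covering_bound tau B &
    0 <= tau].
Proof.
move=> /borel_analytic anA A0 htau.
have [ntau|taun] := ltP n%:R tau; first exact: sparse_complement_dim0.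
have lt_h : ((n%:R - tau)%:E < hausdorff_dim A)%E.
  case: (hausdorff_dim A) htau => [h| |] //=; last by rewrite ltry.
  by rewrite -EFinB !lte_fin; lra.
have [t [t1 t2]] := ereal_between lt_h; rewrite lte_fin in t1.
have t0 : 0 < t by apply: le_lt_trans t1; rewrite subr_ge0.
apply: (sparse_complement anA t0); last by lra.
move=> Ht; move: t2; apply/negP; rewrite -leNgt.
by apply: ereal_inf_lbound; exists t => //; split => //; exact: ltW.
Qed.

Lemma interior_unit_box A : unit_box `<=` A -> interior A !=set0.
Proof.
move=> uA; exists (const_mx (1 / 2)); apply/nbhs_ballP; exists (1 / 2) => //=.
move=> x; rewrite ball_rVE/= => xh; apply: uA => l.
have := le_lt_trans (coord_le_norm _ l) xh; rewrite !mxE ltr_norml => /andP[? ?].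
by apply/andP; split; lra.
Qed.

(** An infinite dimension would yield complements of negative exponent. *)
Lemma hausdorff_dim_fin A : borel A -> A !=set0 ->
  exists h : R, hausdorff_dim A = h%:E.
Proof.
move=> bA A0; case E : (hausdorff_dim A) (hausdorff_dim_ge0 A) => [h| |] //= _.
  by exists h.
have [|_ [_ _ _ +]] := @sparse_complement_dim A (-1) bA A0; last by lra.
by rewrite E /= ltNyr.
Qed.

Definition lattice_translate B (i : nat) : set 'rV[R]_n :=
  if @unpickle 'rV[int]_n i is Some z then [set x + int_vector z | x in B] else B.

Lemma closed_translate B z : closed B -> closed [set x + z | x in B].
Proof.
move=> cB p clp; exists (p - z); last by rewrite subrK.
apply: cB => U /nbhs_ballP[e /= e0 eU].
have [_ [[x Bx <-] px]] := clp _ (nbhsx_ballx p e e0).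
exists x; split => //; apply: eU; move: px; rewrite !ball_rVE /=.
by rewrite (_ : p - z - x = p - (x + z))// opprD addrA addrAC.
Qed.

Lemma borel_lattice_translates B : compact B ->
  borel (\bigcup_i lattice_translate B i).
Proof.
move=> cB; apply: sigma_algebra_bigcup => i.
have clB : closed B.
  by have := @compact_closed 'rV[R]_n B (@norm_hausdorff R 'rV[R]_n); apply.
have cBi : closed (lattice_translate B i).
  rewrite /lattice_translate; case: (unpickle i) => [z|//].
  exact: closed_translate.
rewrite -[lattice_translate B i]setCK; apply: sigma_algebraC.
by apply: sub_sigma_algebra; exact: closed_openC.
Qed.

(** The translates of the unit box by integer vectors tile the space. *)
Lemma lattice_translates_cover A B : unit_box `<=` minkowski_sum A B ->
  minkowski_sum A (\bigcup_i lattice_translate B i) = [set: 'rV[R]_n].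
Proof.
move=> AB; apply/seteqP; split => // x _.
pose z : 'rV[int]_n := \row_i Num.floor (x ord0 i).
have [a Aa [y By ay]] : minkowski_sum A B (x - int_vector z).
  apply: AB => l; rewrite !mxE; have := floor_itv (x ord0 l).
  by rewrite rmorphD/= rmorph1 => /andP[? ?]; apply/andP; split; lra.
exists a => //; exists (y + int_vector z); last by rewrite addrA ay subrK.
exists (pickle z) => //; rewrite /lattice_translate pickleK.
by exists y.
Qed.

(** The three formulas share one pattern: every admissible [B] has dimension at
    least [n - dim_H A], and sparse complements come arbitrarily close. *)
Lemma codim_formula A (h : R) (P : set (set 'rV[R]_n))
    (d : set 'rV[R]_n -> \bar R) : hausdorff_dim A = h%:E ->
  (forall B, P B -> (n%:R - h)%:E <= d B)%E ->
  (forall tau, n%:R - h < tau -> exists2 B, P B & (d B <= tau%:E)%E) ->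
  hausdorff_dim A = (n%:R%:E - ereal_inf [set d B | B in P])%E.
Proof.
move=> hE lower upper.
suff -> : ereal_inf [set d B | B in P] = (n%:R - h)%:E.
  by rewrite hE -EFinB; congr EFin; ring.
apply/le_anti/andP; split; last first.
  by apply: le_ereal_inf_tmp => _ [B PB <-]; exact: lower.
apply/lee_addgt0Pr => e e0.
have [|B PB dB] := upper (n%:R - h + e); first by rewrite ltrDl.
by apply: le_trans dB; apply: ereal_inf_lbound; exists B.
Qed.

End Codimension.

Theorem theorem1p7 (R : realType) (n : nat) (hn : (1 <= n)%N)
    (A : set 'rV[R]_n) (hA0 : A !=set0) (hA : borel A) :
  [/\ hausdorff_dim A =
        (n%:R%:E - ereal_inf [set upper_minkowski_dim B | B in
          [set B : set 'rV[R]_n | compact B /\ interior (minkowski_sum A B) !=set0]])%E,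
      hausdorff_dim A =
        (n%:R%:E - ereal_inf [set packing_dim B | B in
          [set B : set 'rV[R]_n | compact B /\ interior (minkowski_sum A B) !=set0]])%E &
      hausdorff_dim A =
        (n%:R%:E - ereal_inf [set packing_dim B | B in
          [set B : set 'rV[R]_n | borel B /\ minkowski_sum A B = [set: 'rV[R]_n]]])%E].
Proof.
have [h hE] := hausdorff_dim_fin hA hA0.
have lower B : interior (minkowski_sum A B) !=set0 ->
    ((n%:R - h)%:E <= packing_dim B)%E.
  by move=> /sum_dim_ge; rewrite hE EFinB leeBlDl.
have lowerM B : interior (minkowski_sum A B) !=set0 ->
    ((n%:R - h)%:E <= upper_minkowski_dim B)%E.
  move=> iAB; apply: (le_trans (lower B iAB)); apply: packing_dim_le_minkowski.
  have [x0 xi] := iAB; have [a _ [b Bb _]] := interior_subset xi.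
  by exists b.
have upper tau : n%:R - h < tau -> exists2 B, [/\ compact B,
    unit_box `<=` minkowski_sum A B & interior (minkowski_sum A B) !=set0] &
    exists2 tau0, covering_bound tau0 B & 0 <= tau0 < tau.
  move=> htau.
  have hmid : (n%:R%:E - hausdorff_dim A < ((n%:R - h + tau) / 2)%:E)%E.
    by rewrite hE -EFinB lte_fin; lra.
  have [B [cB uB cb t0]] := sparse_complement_dim hA hA0 hmid.
  exists B; first by split => //; exact: interior_unit_box uB.
  by exists ((n%:R - h + tau) / 2) => //; rewrite t0/=; lra.
split; apply: (codim_formula hE).
- by move=> B [_ /lowerM].
- move=> tau /upper[B [cB uB iB] [tau0 cb /andP[t0 tt]]]; exists B => //.
  exact: upper_minkowski_dim_le cb tt.
- by move=> B [_ /lower].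
- move=> tau /upper[B [cB uB iB] [tau0 cb /andP[t0 tt]]]; exists B => //.
  have u0 : 0 <= tau by exact: le_trans (ltW tt).
  apply: (packing_dim_le (E := fun=> B)) => // [x Bx|_]; first by exists 0%N.
  exact: packing_premeasure0 cb tt u0.
- move=> B [_ AB]; apply: lower; rewrite AB interiorT.
  by exists 0.
- move=> tau /upper[B [cB uB iB] [tau0 cb /andP[t0 tt]]].
  have u0 : 0 <= tau by exact: le_trans (ltW tt).
  exists (\bigcup_i lattice_translate B i).
    by split; [exact: borel_lattice_translates|exact: lattice_translates_cover].
  apply: (packing_dim_le (E := lattice_translate B)) => // i.
  apply: packing_premeasure0 tt u0; rewrite /lattice_translate.
  by case: (unpickle i) => [z|//]; exact: covering_bound_translate.
Qed.
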